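(* Let $K$ be a (commutative) Noetherian ring, let $c\ge 0$ be an integer and let $\mathcal{P}=K[X_{c\times\mathbb{N}}]$. Then any $\operatorname{Sym}$-submodule $\mathcal{M}$ of a finitely generated free $\operatorname{Sym}$-module over $\mathcal{P}$ admits a $\operatorname{Sym}$-equivariant free resolution, that is, there is an exact sequence $$\cdots\to\mathcal{F}_2\to\mathcal{F}_1\to\mathcal{M}\to 0$$ with $\operatorname{Sym}$-equivariant differentials and free $\mathcal{P}$-modules $\mathcal{F}_i$ that are finitely generated as $\operatorname{Sym}$-modules. Moreover, if $\mathcal{M}$ is a graded module, then a graded such resolution exists, i.e. the differentials have degree zero.
   Context: $\mathbb{N}=\{1,2,\dots\}$. $\operatorname{Sym}$ is the group of bijections $\pi\colon\mathbb{N}\to\mathbb{N}$ with $\pi(i)\ne i$ for only finitely many $i$. $\mathcal{P}=K[X_{c\times\mathbb{N}}]=K[x_{i,j}\mid1\le i\le c,\ j\in\mathbb{N}]$, with $\operatorname{Sym}$ acting by $K$-algebra homomorphisms via $\tau\cdot x_{i,j}=x_{i,\tau(j)}$. A $\operatorname{Sym}$-module over $\mathcal{P}$ is a $\mathcal{P}$-module $\mathcal{M}$ with an action of $\operatorname{Sym}$ satisfying $\tau\cdot(q_1+q_2)=\tau\cdot q_1+\tau\cdot q_2$ and $\tau\cdot(aq)=(\tau\cdot a)(\tau\cdot q)$ for $\tau\in\operatorname{Sym}$, $a\in\mathcal{P}$, $q,q_1,q_2\in\mathcal{M}$. Morphisms are the $\operatorname{Sym}$-equivariant $\mathcal{P}$-module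 homomorphisms. A $\operatorname{Sym}$-submodule is a $\mathcal{P}$-submodule stable under $\operatorname{Sym}$. A $\operatorname{Sym}$-module is finitely generated if there is a finite subset not contained in any proper $\operatorname{Sym}$-submodule. For $d\ge0$ let $\operatorname{Hom}_{\mathrm{FI}}(d,\mathbb{N})$ be the set of injective maps $\{1,\dots,d\}\to\mathbb{N}$. Let $\mathcal{F}^{\operatorname{Sym},d}=\bigoplus_{\pi\in\operatorname{Hom}_{\mathrm{FI}}(d,\mathbb{N})}\mathcal{P}\,\epsilon_\pi$ with action induced by $\tau\cdot(a\epsilon_\pi)=(\tau\cdot a)\epsilon_{\tau\circ\pi}$. A finitely generated free $\operatorname{Sym}$-module over $\mathcal{P}$ is one isomorphic to a finite direct sum $\bigoplus_{i=1}^r\mathcal{F}^{\operatorname{Sym},d_i}$. Gradings: $\mathcal{P}$ has the standard grading in which every variable has degree one. A graded $\operatorname{Sym}$-module is a $\operatorname{Sym}$-module with a $\mathbb{Z}$-grading making it a graded $\mathcal{P}$-module such that the action of $\operatorname{Sym}$ preserves degrees. *)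

(* Defs.v *)
From HB Require Import structures.
From mathcomp Require Import all_boot all_order all_algebra finmap.
From mathcomp Require Import boolp classical_sets monalg.

Set Implicit Arguments.
Unset Strict Implicit.
Unset Printing Implicit Defensive.

Import GRing.Theory.

Local Open Scope ring_scope.

(* The index set {1, 2, ...} of the column indices is represented by nat,
   i.e. it is shifted to start at 0. *)
Record Sym : Type := MkSym {
  sym_fun :> nat -> nat;
  sym_bij : bijective sym_fun;
  sym_fin : exists s : seq nat, forall i, sym_fun i <> i -> i \in s }.

Lemma sym_ext (s t : Sym) : s =1 t -> s = t.
Proof.
case: s t => [f fb ff] [g gb gf] /= /funext fg; subst g.
by rewrite (Prop_irrelevance fb gb) (Prop_irrelevance ff gf).
Qed.

Lemma sym_inj (s : Sym) : injective s.
Proof. exact: bij_inj (sym_bij s). Qed.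

Program Definition sym_one : Sym := @MkSym id _ _.
Next Obligation. by exists id. Qed.
Next Obligation. by exists [::]. Qed.

(* Unlike for {perm T}, products compose right to left: (s * t) i = s (t i). *)
Program Definition sym_mul (s t : Sym) : Sym := @MkSym (s \o t) _ _.
Next Obligation. exact: bij_comp (sym_bij s) (sym_bij t). Qed.
Next Obligation.
have [[us hs] [ut ht]] := (sym_fin s, sym_fin t).
exists (us ++ ut) => i; rewrite mem_cat; have [->|/eqP ti] := eqVneq (t i) i.
  by move=> /hs ->.
by rewrite (ht _ ti) orbT.
Qed.

Lemma sym_surj (s : Sym) j : exists i, s i == j.
Proof. by have [g _ gK] := sym_bij s; exists (g j); rewrite gK. Qed.

Definition sym_inv_fun (s : Sym) j := xchoose (sym_surj s j).

Lemma sym_inv_funK (s : Sym) : cancel (sym_inv_fun s) s.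
Proof. by move=> j; apply/eqP/(xchooseP (sym_surj s j)). Qed.

Lemma sym_funK (s : Sym) : cancel s (sym_inv_fun s).
Proof. by move=> i; apply: (@sym_inj s); rewrite sym_inv_funK. Qed.

Program Definition sym_inv (s : Sym) : Sym := @MkSym (sym_inv_fun s) _ _.
Next Obligation. exists s; [exact: sym_inv_funK | exact: sym_funK]. Qed.
Next Obligation.
have [u hu] := sym_fin s; exists u => j hj; apply: hu => sj.
by apply: hj; rewrite -{1}sj sym_funK.
Qed.

HB.instance Definition _ := gen_eqMixin Sym.
HB.instance Definition _ := gen_choiceMixin Sym.

Fact sym_mulA : associative sym_mul.
Proof. by move=> s t u; apply: sym_ext. Qed.
Fact sym_mul1 : left_id sym_one sym_mul.
Proof. by move=> s; apply: sym_ext. Qed.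
Fact sym_mulr1 : right_id sym_one sym_mul.
Proof. by move=> s; apply: sym_ext. Qed.
Fact sym_mulV : left_inverse sym_one sym_inv sym_mul.
Proof. by move=> s; apply: sym_ext; exact: sym_funK. Qed.
Fact sym_mulrV : right_inverse sym_one sym_inv sym_mul.
Proof. by move=> s; apply: sym_ext; exact: sym_inv_funK. Qed.

HB.instance Definition _ :=
  isGroup.Build Sym sym_mulA sym_mul1 sym_mulr1 sym_mulV sym_mulrV.

Definition polyInf (K : comNzRingType) (c : nat) : Type :=
  {malg K[{cmonom ('I_c * nat)%type}]}.
HB.instance Definition _ (K : comNzRingType) (c : nat) :=
  GRing.ComAlgebra.on (polyInf K c).

Lemma scale_malgU (R : comNzRingType) (I : choiceType) (a b : R) (i : I) :
  a *: << b *g i >> = << a * b *g i >>.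
Proof. by apply/malgP => k; rewrite mcoeffZ !mcoeffU mulrnAr. Qed.

Section PolyAct.
Variables (K : comNzRingType) (c : nat).
Local Notation P := (polyInf K c).
Local Notation mon := {cmonom ('I_c * nat)%type}.

Definition polyX (v : 'I_c * nat) : P := << ucm v >>.

Definition monact (s : Sym) (m : mon) : P :=
  \prod_(v <- finsupp m) polyX (v.1, s v.2) ^+ m v.

(* The K-algebra endomorphism x_(i,j) |-> x_(i,s j). *)
Definition polyact (s : Sym) (p : P) : P :=
  mmap (malgC : K -> {malg K[mon]}) (monact s) p.

Lemma monactEw (s : Sym) (m : mon) (d : {fset ('I_c * nat)%type}) :
  (finsupp m `<=` d)%fset ->
  monact s m = \prod_(v <- d) polyX (v.1, s v.2) ^+ m v.
Proof.
move=> le; rewrite /monact (big_fset_incl _ le) //= => v _.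
by rewrite -cmE_eq0 => /eqP ->; rewrite expr0.
Qed.

Fact monact_mmorphism s : mmorphism (monact s).
Proof.
split=> [m1 m2|]; last by rewrite /monact mdom1 big_seq_fset0.
rewrite {1}/monact mdomD (monactEw s (fsubsetUl _ (finsupp m2))).
rewrite (monactEw s (fsubsetUr (finsupp m1) _)) -big_split /=.
by apply: eq_bigr => v _; rewrite cmM exprD.
Qed.
HB.instance Definition _ s :=
  isMultiplicative.Build mon P (monact s) (monact_mmorphism s).

Fact polyact_is_additive s : additive (polyact s).
Proof. exact: mmap_is_additive. Qed.
HB.instance Definition _ s :=
  GRing.isAdditive.Build P P (polyact s) (polyact_is_additive s).
Fact polyact_is_multiplicative s : multiplicative (polyact s).
Proof. exact: mmap_is_multiplicative. Qed.
HB.instance Definition _ s :=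
  GRing.isMultiplicative.Build P P (polyact s) (polyact_is_multiplicative s).

Lemma polyactC s (a : K) : polyact s (malgC a : P) = malgC a.
Proof. exact: mmapC. Qed.

Lemma polyactX s i j : polyact s (polyX (i, j)) = polyX (i, s j).
Proof.
rewrite /polyact /polyX mmapU /= /monact mdomU big_seq_fset1 cmUU expr1.
exact: mul1r.
Qed.

Lemma polyactZ s (a : K) p : polyact s (a *: p) = a *: polyact s p.
Proof. by rewrite -!mul_malgC [LHS](rmorphM (polyact s)) [X in X * _](polyactC s a). Qed.

Lemma malgU_prod (m : mon) :
  << m >> = \prod_(v <- finsupp m) polyX v ^+ m v :> P.
Proof.
have UM (m1 m2 : mon) : << mmul m1 m2 >> = << m1 >> * << m2 >> :> P.
  by rewrite malgM_def fgmulUU mulr1.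
have UX (v : 'I_c * nat) n : polyX v ^+ n = << expcmn (ucm v) n >>.
  elim: n => [|n IHn]; first by [].
  rewrite exprS IHn -UM; congr << _ >>.
  case: n {IHn} => [|n] //; first by apply/eqP/cmP => i; rewrite cmM cm1 addn0.
have {1}-> : m = \big[mmul/mone]_(v <- finsupp m) expcmn (ucm v) (m v).
  have En v n w : expcmn (ucm v) n w = ((v == w) * n)%N :> nat.
    elim: n => [|[|n] IHn]; rewrite ?muln0 ?cm1 //; first by rewrite cmU muln1.
    by rewrite cmM IHn cmU -mulnS.
  apply/eqP/cmP => w.
  have -> : (\big[mmul/mone]_(v <- finsupp m) expcmn (ucm v) (m v)) w
      = (\sum_(v <- finsupp m) expcmn (ucm v) (m v) w)%N.
    by apply: (big_morph (fun x : mon => x w)) => [x y|]; rewrite ?cmM ?cm1.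
  under eq_bigr do rewrite En.
  have [wm|wm] := boolP (w \in finsupp m).
    rewrite (big_fsetD1 w) //= eqxx mul1n big1_fset ?addn0 // => v.
    by rewrite in_fsetD1 => /andP[/negPf ->].
  rewrite big1_fset; first by apply/eqP; rewrite cmE_eq0.
  move=> v vm _; case: eqP => [vw|] //.
  by rewrite -vw vm in wm.
rewrite (big_morph (fun x : mon => << x >> : P) UM (erefl _)).
by apply: eq_bigr => v _; rewrite UX.
Qed.

Lemma poly_morph_ext (f g : {rmorphism P -> P}) :
  (forall a : K, f (malgC a) = g (malgC a)) ->
  (forall v, f (polyX v) = g (polyX v)) -> f =1 g.
Proof.
move=> fgC fgX p; rewrite (monalgE p) !rmorph_sum; apply: eq_bigr => m _ /=.
have -> : << p@_m *g m >> = malgC p@_m * << m >> :> P.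
  by rewrite malgM_def fgmulUU mulr1 mul1m.
have fgm : f << m >> = g << m >>.
  rewrite (malgU_prod m) (rmorph_prod f) (rmorph_prod g).
  by apply: eq_bigr => v _; rewrite (rmorphXn f) (rmorphXn g) fgX.
rewrite [LHS](rmorphM f) [RHS](rmorphM g).
by congr (_ * _); [exact: fgC | exact: fgm].
Qed.

Lemma polyact1 p : polyact 1%g p = p.
Proof.
apply: (poly_morph_ext (f := polyact 1%g) (g := idfun)) => [a|[i j]] /=.
  exact: polyactC.
exact: polyactX.
Qed.

Lemma polyactM (s t : Sym) p : polyact (s * t)%g p = polyact s (polyact t p).
Proof.
apply: (poly_morph_ext (f := polyact (s * t)%g)
  (g := (polyact s \o polyact t))) => [a|[i j]] /=.
  by rewrite !polyactC.
by rewrite !polyactX.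
Qed.

End PolyAct.

HB.mixin Record Lmodule_isSymModule (K : comNzRingType) (c : nat) M
    of GRing.Lmodule (polyInf K c) M := {
  symact : Sym -> M -> M;
  symact1 : forall q, symact 1%g q = q;
  symactM : forall s t q, symact (s * t)%g q = symact s (symact t q);
  symactD : forall s q1 q2, symact s (q1 + q2) = symact s q1 + symact s q2;
  symactZ : forall s (a : polyInf K c) q,
    symact s (a *: q) = polyact s a *: symact s q }.

#[short(type="symModType")]
HB.structure Definition SymModule (K : comNzRingType) (c : nat) :=
  { M of GRing.Lmodule (polyInf K c) M & Lmodule_isSymModule K c M }.

Section SymModules.
Variables (K : comNzRingType) (c : nat).
Local Notation P := (polyInf K c).

Definition equivariant (M N : symModType K c) (f : M -> N) :=
  forall s q, f (symact s q) = symact s (f q).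

Record is_sym_submodule (F : symModType K c) (M : set F) : Prop := {
  subm0 : M 0;
  submD : forall x y, M x -> M y -> M (x + y);
  submZ : forall (a : P) x, M x -> M (a *: x);
  subm_act : forall s x, M x -> M (symact s x) }.

Definition sym_fin_gen (F : symModType K c) : Prop :=
  exists g : seq F, forall N : set F, is_sym_submodule N ->
    (forall x, x \in g -> N x) -> forall x, N x.

Definition HomFI (d : nat) : Type := {f : {ffun 'I_d -> nat} | injectiveb f}.
HB.instance Definition _ d := Choice.on (HomFI d).

Program Definition fi_comp d (s : Sym) (f : HomFI d) : HomFI d :=
  exist _ [ffun i => s (val f i)] _.
Next Obligation.
have /injectiveP f_inj := valP f; apply/injectiveP => i j /=.
by rewrite !ffunE => /sym_inj /f_inj.
Qed.

(* The direct sum of copies of P over HomFI d, where << 1 *g f >> is the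
   basis vector indexed by f. *)
Definition freeSym (d : nat) : Type := {malg P[HomFI d]}.
HB.instance Definition _ d := GRing.Lmodule.on (freeSym d).

Definition freeSym_act d (s : Sym) (x : freeSym d) : freeSym d :=
  \sum_(f <- msupp x) << polyact s x@_f *g fi_comp s f >>.

Lemma freeSym_actEw d s (x : freeSym d) (D : {fset HomFI d}) :
  (msupp x `<=` D)%fset ->
  freeSym_act s x = \sum_(f <- D) << polyact s x@_f *g fi_comp s f >>.
Proof.
move=> le; rewrite /freeSym_act (big_fset_incl _ le) //= => f _ /mcoeff_outdom ->.
by rewrite raddf0 monalgU0.
Qed.

Lemma freeSym_actU d s (a : P) (f : HomFI d) :
  freeSym_act s << a *g f >> = << polyact s a *g fi_comp s f >>.
Proof. by rewrite (freeSym_actEw s msuppU_le) big_seq_fset1 mcoeffUU. Qed.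

Fact freeSym_actD d s (x y : freeSym d) :
  freeSym_act s (x + y) = freeSym_act s x + freeSym_act s y.
Proof.
rewrite (freeSym_actEw s (msuppD_le x y)).
rewrite (freeSym_actEw s (fsubsetUl (msupp x) (msupp y))).
rewrite (freeSym_actEw s (fsubsetUr (msupp x) (msupp y))) -big_split /=.
by apply: eq_bigr => f _; rewrite mcoeffD !raddfD.
Qed.

Fact freeSym_actZ d s (a : P) (x : freeSym d) :
  freeSym_act s (a *: x) = polyact s a *: freeSym_act s x.
Proof.
rewrite (freeSym_actEw s (msuppZ_le a x)) /freeSym_act scaler_sumr.
apply: eq_bigr => f _; rewrite mcoeffZ.
have -> : polyact s (a * x@_f) = polyact s a * polyact s x@_f by exact: rmorphM.
by rewrite [RHS]scale_malgU.
Qed.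

Lemma freeSym_ind d (Q : freeSym d -> Prop) :
  Q 0 -> (forall x y, Q x -> Q y -> Q (x + y)) ->
  (forall a f, Q << a *g f >>) -> forall x, Q x.
Proof. by move=> Q0 QD QU x; rewrite (monalgE x); apply: big_ind. Qed.

Lemma freeSym_act0 d s : freeSym_act s (0 : freeSym d) = 0.
Proof. by rewrite /freeSym_act msupp0 big_seq_fset0. Qed.

Lemma fi_comp1 d (f : HomFI d) : fi_comp 1%g f = f.
Proof. by apply/val_inj/ffunP => i; rewrite ffunE. Qed.

Lemma fi_compM d s t (f : HomFI d) :
  fi_comp (s * t)%g f = fi_comp s (fi_comp t f).
Proof. by apply/val_inj/ffunP => i; rewrite !ffunE. Qed.

Fact freeSym_act1 d (x : freeSym d) : freeSym_act 1%g x = x.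
Proof.
elim/freeSym_ind: x => [|x y IHx IHy|a f]; first exact: freeSym_act0.
  by rewrite freeSym_actD IHx IHy.
by rewrite freeSym_actU polyact1 fi_comp1.
Qed.

Fact freeSym_actM d s t (x : freeSym d) :
  freeSym_act (s * t)%g x = freeSym_act s (freeSym_act t x).
Proof.
elim/freeSym_ind: x => [|x y IHx IHy|a f]; first by rewrite !freeSym_act0.
  by rewrite !freeSym_actD IHx IHy.
by rewrite !freeSym_actU polyactM fi_compM.
Qed.

HB.instance Definition _ d := Lmodule_isSymModule.Build K c (freeSym d)
  (@freeSym_act1 d) (@freeSym_actM d) (@freeSym_actD d) (@freeSym_actZ d).

End SymModules.

Section DirectSum.
Variables (K : comNzRingType) (c : nat) (I : finType) (M : I -> symModType K c).
Local Notation P := (polyInf K c).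

Definition dirsum : Type := {dffun forall i, M i}.
HB.instance Definition _ := Choice.on dirsum.

Definition ds_add (x y : dirsum) : dirsum := [ffun i => x i + y i].
Definition ds_opp (x : dirsum) : dirsum := [ffun i => - x i].
Definition ds_zero : dirsum := [ffun i => 0].
Definition ds_scale (a : P) (x : dirsum) : dirsum := [ffun i => a *: x i].
Definition ds_act (s : Sym) (x : dirsum) : dirsum := [ffun i => symact s (x i)].

Fact ds_addA : associative ds_add.
Proof. by move=> x y z; apply/ffunP => i; rewrite !ffunE addrA. Qed.
Fact ds_addC : commutative ds_add.
Proof. by move=> x y; apply/ffunP => i; rewrite !ffunE addrC. Qed.
Fact ds_add0 : left_id ds_zero ds_add.
Proof. by move=> x; apply/ffunP => i; rewrite !ffunE add0r. Qed.
Fact ds_addN : left_inverse ds_zero ds_opp ds_add.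
Proof. by move=> x; apply/ffunP => i; rewrite !ffunE addNr. Qed.

HB.instance Definition _ :=
  GRing.isZmodule.Build dirsum ds_addA ds_addC ds_add0 ds_addN.

Fact ds_scaleA a b x : ds_scale a (ds_scale b x) = ds_scale (a * b) x.
Proof. by apply/ffunP => i; rewrite !ffunE scalerA. Qed.
Fact ds_scale1 : left_id 1 ds_scale.
Proof. by move=> x; apply/ffunP => i; rewrite !ffunE scale1r. Qed.
Fact ds_scaleDr : right_distributive ds_scale +%R.
Proof. by move=> a x y; apply/ffunP => i; rewrite !ffunE scalerDr. Qed.
Fact ds_scaleDl x : {morph ds_scale^~ x : a b / a + b}.
Proof. by move=> a b; apply/ffunP => i; rewrite !ffunE scalerDl. Qed.

HB.instance Definition _ := GRing.Zmodule_isLmodule.Build P dirsum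
  ds_scaleA ds_scale1 ds_scaleDr ds_scaleDl.

Fact ds_act1 x : ds_act 1%g x = x.
Proof. by apply/ffunP => i; rewrite !ffunE symact1. Qed.
Fact ds_actM s t x : ds_act (s * t)%g x = ds_act s (ds_act t x).
Proof. by apply/ffunP => i; rewrite !ffunE symactM. Qed.
Fact ds_actD s x y : ds_act s (x + y) = ds_act s x + ds_act s y.
Proof. by apply/ffunP => i; rewrite !ffunE symactD. Qed.
Fact ds_actZ s (a : P) x : ds_act s (a *: x) = polyact s a *: ds_act s x.
Proof. by apply/ffunP => i; rewrite !ffunE symactZ. Qed.

HB.instance Definition _ := Lmodule_isSymModule.Build K c dirsum
  ds_act1 ds_actM ds_actD ds_actZ.

End DirectSum.

Definition is_ideal (R : comNzRingType) (I : set R) : Prop :=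
  [/\ I 0, forall x y, I x -> I y -> I (x + y) & forall a x, I x -> I (a * x)].

Definition noetherian (R : comNzRingType) : Prop :=
  forall I : set R, is_ideal I -> exists (n : nat) (g : 'I_n -> R),
    forall x, I x <-> exists a : 'I_n -> R, x = \sum_(i < n) a i * g i.

Definition is_basis (R : comNzRingType) (M : lmodType R) (I : choiceType)
    (b : I -> M) : Prop :=
  forall x, exists! a : {malg R[I]}, x = \sum_(i <- msupp a) a@_i *: b i.

Definition free_module (R : comNzRingType) (M : lmodType R) : Prop :=
  exists (I : choiceType) (b : I -> M), is_basis b.

Section Resolutions.
Variables (K : comNzRingType) (c : nat).
Local Notation P := (polyInf K c).

Definition fin_gen_free_sym (F : symModType K c) : Prop :=
  exists (r : nat) (d : 'I_r -> nat)
    (f : {linear F -> dirsum (fun i => freeSym K c (d i) : symModType K c)}),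
    equivariant f /\ bijective f.

Definition homogeneous (n : nat) (a : P) : Prop :=
  forall m, m \in msupp a -> mdeg m = n.

(* A Z-grading of the Sym-submodule M of F; the grading of F itself is
   obtained for M := setT. *)
Record is_grading (F : symModType K c) (M : set F) (gr : int -> set F) :
    Prop := {
  gr_sub : forall k x, gr k x -> M x;
  gr_zero : forall k, gr k 0;
  gr_subr : forall k x y, gr k x -> gr k y -> gr k (x - y);
  gr_decomp : forall x, M x -> exists! u : {malg F[int]},
    (forall k, gr k u@_k) /\ x = \sum_(k <- msupp u) u@_k;
  gr_scale : forall (n : nat) (k : int) (a : P) x,
    homogeneous n a -> gr k x -> gr (n%:Z + k) (a *: x);
  gr_act : forall k s x, gr k x -> gr k (symact s x) }.

(* res_term n stands for F_(n+1). *)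
Record sym_complex (F : symModType K c) := SymComplex {
  res_term : nat -> symModType K c;
  res_aug : {linear res_term 0%N -> F};
  res_diff : forall n, {linear res_term n.+1 -> res_term n} }.

Record is_sym_free_resolution (F : symModType K c) (M : set F)
    (C : sym_complex F) : Prop := {
  res_free : forall n, free_module (res_term C n);
  res_fin_gen : forall n, sym_fin_gen (res_term C n);
  res_aug_equiv : equivariant (res_aug C);
  res_diff_equiv : forall n, equivariant (res_diff C n);
  res_aug_onto : forall x, M x <-> exists y, res_aug C y = x;
  res_exact0 : forall y,
    res_aug C y = 0 <-> exists z, res_diff C 0%N z = y;
  res_exactS : forall n y,
    res_diff C n y = 0 <-> exists z, res_diff C n.+1 z = y }.

Definition graded_free (F : symModType K c) (gr : int -> set F) : Prop :=
  is_grading setT gr /\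
  exists (I : choiceType) (b : I -> F) (deg : I -> int),
    is_basis b /\ forall i, gr (deg i) (b i).

Record is_graded_resolution (F : symModType K c) (gr : int -> set F)
    (C : sym_complex F) (grC : forall n, int -> set (res_term C n)) :
    Prop := {
  res_graded : forall n, graded_free (grC n);
  res_aug_deg : forall k y, grC 0%N k y -> gr k (res_aug C y);
  res_diff_deg : forall n k y, grC n.+1 k y -> grC n k (res_diff C n y) }.

End Resolutions.

(* Main.v *)
(* A monomial of a finite direct sum of modules F^{Sym,d} is encoded by its list
   of columns, so by Higman's lemma divisibility up to strictly increasing column
   maps is a well-quasi-order, and it is compatible with a monomial well-order.
   Strictly increasing maps agree with finitary permutations on any finite set of
   columns, so over a Noetherian K a leading term argument shows that all
   Sym-submodules are finitely generated.  Since every element is fixed by all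
   permutations fixing the first n columns for some n, finitely many (homogeneous)
   generators give an equivariant cover by a free module; its kernel is again a
   (graded) submodule of a finitely generated free module, and one iterates. *)

From HB Require Import structures.
Require Import Defs.
From mathcomp Require Import all_boot all_order all_algebra finmap.
From mathcomp Require Import boolp classical_sets monalg.
From mathcomp Require Import zify.

Set Implicit Arguments.
Unset Strict Implicit.
Unset Printing Implicit Defensive.

Import GRing.Theory.

Local Open Scope ring_scope.

(** * Well-quasi-orders *)

(** A finitary permutation has finite order, so one that moves some monomial preserves no total
    order on the monomials. The leading term argument is therefore stated abstractly through
    [dvd_shift], where the operation [op] depends on the pair [t], [u] and is controlled only on
    elements whose monomials are all at most [t]. This dictates the order: with the highest column
    most significant, everything below [t] lives in the columns of [t], and there the permutation
    can be taken increasing. Over a ring one divisible pair of leading monomials does not suffice,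
    because several leading coefficients have to be combined; an infinite chain is needed, and
    well-quasi-orders are defined accordingly. The graded and the ungraded statement come from one
    construction in which the variables have weight [w], equal to 1 or 0. *)

Definition smono (g : nat -> nat) := forall i j, (i < j)%N -> (g i < g j)%N.

(** In this form a conjunction of two relations is handled by passing to a subsequence twice. *)
Definition wqo T (r : T -> T -> Prop) := forall u : nat -> T,
  exists2 g, smono g & forall i j, (i < j)%N -> r (u (g i)) (u (g j)).

Lemma smono_succ g : (forall i, g i < g i.+1)%N -> smono g.
Proof.
move=> gS i; elim=> // j IHj; rewrite ltnS leq_eqVlt => /orP[/eqP->//|/IHj].
by move/ltn_trans; apply.
Qed.

Lemma smono_le g i j : smono g -> (i <= j)%N -> (g i <= g j)%N.
Proof. by move=> gm; rewrite leq_eqVlt => /orP[/eqP->//|/gm/ltnW]. Qed.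

Lemma cofinal_smono (P : nat -> Prop) :
  (forall n, exists m, (n < m)%N /\ P m) -> exists2 g, smono g & forall i, P (g i).
Proof.
move=> /choice[f fP]; exists (fun n => iter n.+1 f 0%N) => [|i].
  by apply: smono_succ => i; case: (fP (iter i.+1 f 0%N)).
by case: (fP (iter i f 0%N)).
Qed.

(** Indices without a later [r]-successor are bounded, since infinitely many of them would form a
    sequence with no good pair. Beyond the bound, successors can be chosen one after another. *)
Lemma good_wqo T (r : T -> T -> Prop) : (forall x y z, r x y -> r y z -> r x z) ->
  (forall u : nat -> T, exists i j, (i < j)%N /\ r (u i) (u j)) -> wqo r.
Proof.
move=> rtr good u.
have [N hN] : exists N, forall i, (N <= i)%N -> exists j, (i < j)%N /\ r (u i) (u j).
  apply: contrapT => noN.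
  have [|g gm gP] := @cofinal_smono (fun i => forall j, (i < j)%N -> ~ r (u i) (u j)).
    move=> n; apply: contrapT => Hn; apply: noN; exists n.+1 => i ni.
    apply: contrapT => Hi; apply: Hn; exists i; split=> // j ij rij.
    by apply: Hi; exists j.
  have [i [j [ij rij]]] := good (u \o g).
  exact: gP (gm _ _ ij) rij.
have /choice[f fP] : forall i, exists j,
    (N <= i)%N -> (i < j)%N /\ r (u i) (u j).
  move=> i; case: (leqP N i) => [/hN[j ?]|?]; last by exists 0%N.
  by exists j.
pose g n := iter n f N.
have gN n : (N <= g n)%N.
  elim: n => //= n IHn; have [/ltnW + _] := fP _ IHn; exact: leq_trans.
exists g => [|i].
  by apply: smono_succ => i; have [] := fP _ (gN i).
elim=> // j IHj; rewrite ltnS leq_eqVlt => /orP[/eqP->|/IHj ri].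
  by have [] := fP _ (gN j).
by apply: rtr ri _; have [] := fP _ (gN j).
Qed.

Lemma wqo_nat : wqo (fun m n : nat => (m <= n)%N).
Proof.
apply: good_wqo => [x y z|u]; first exact: leq_trans.
have [m [k um] mmin] : exists2 m, (exists k, u k = m) & forall k, (m <= u k)%N.
  have ex : exists m, `[< exists k, u k = m >] by exists (u 0%N); apply/asboolP; exists 0%N.
  case: (ex_minnP ex) => m /asboolP hm mmin; exists m => // k.
  by apply: mmin; apply/asboolP; exists k.
by exists k, k.+1; split=> //; rewrite um.
Qed.

Lemma wqo_and T (r s : T -> T -> Prop) : wqo r -> wqo s ->
  wqo (fun x y => r x y /\ s x y).
Proof.
move=> wr ws u; have [g gm gP] := wr u; have [h hm hP] := ws (u \o g).
exists (g \o h) => [i j ij|i j ij]; first exact/gm/hm.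
by split; [exact/gP/hm | exact: hP].
Qed.

Lemma wqo_comp T S (f : S -> T) r : wqo r -> wqo (fun x y => r (f x) (f y)).
Proof. by move=> wr u; exact: wr (f \o u). Qed.

Lemma dickson n :
  wqo (fun x y : nat -> nat => forall a, (a < n)%N -> (x a <= y a)%N).
Proof.
elim: n => [u|n IHn]; first by exists id.
have := wqo_and IHn (wqo_comp (fun x : nat -> nat => x n) wqo_nat).
move=> w u; have [g gm gP] := w u; exists g => // i j ij a.
by have [h1 h2] := gP i j ij; rewrite ltnS leq_eqVlt => /orP[/eqP->|/h1].
Qed.

(** * Higman's lemma *)

Section Higman.
Variables (A : Type) (le : A -> A -> Prop).

Inductive emb : seq A -> seq A -> Prop :=
| emb_nil v : emb [::] v
| emb_skip b u v : emb u v -> emb u (b :: v)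
| emb_cons a b u v : le a b -> emb u v -> emb (a :: u) (b :: v).

Lemma emb_trans : (forall x y z, le x y -> le y z -> le x z) ->
  forall u v w, emb u v -> emb v w -> emb u w.
Proof.
move=> letr u v w uv vw; elim: vw u uv => {v w} [v|b v w vw IH|a b v w ab vw IH] u uv.
- by inversion uv; apply: emb_nil.
- by apply: emb_skip; apply: IH.
- inversion uv; subst; first exact: emb_nil.
    by apply: emb_skip; apply: IH.
  apply: emb_cons; first exact: letr ab.
  exact: IH.
Qed.

Lemma emb_smono x0 u v : emb u v -> exists f : nat -> nat,
  [/\ forall i, (i < size u)%N -> (f i < size v)%N,
      forall i j, (i < j < size u)%N -> (f i < f j)%N
    & forall i, (i < size u)%N -> le (nth x0 u i) (nth x0 v (f i))].
Proof.
elim=> {u v} [v|b u v _ [f [f1 f2 f3]]|a b u v ab _ [f [f1 f2 f3]]].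
- by exists id; split=> //= i j; rewrite ltn0 andbF.
- exists (S \o f); split=> //= [i /f1//|i j /f2//].
- exists (fun i => if i is k.+1 then (f k).+1 else 0%N).
  split=> [[|i]//=|[|i] [|j]//=|[|i]//=]; last exact: f3.
    by rewrite !ltnS; exact: f1.
  by rewrite !ltnS; exact: f2.
Qed.

Let bad (u : nat -> seq A) := forall i j, (i < j)%N -> ~ emb (u i) (u j).
Let agree n (u v : nat -> seq A) := forall i, (i < n)%N -> u i = v i.

                                                   
(* Nash-Williams' minimal bad sequence argument. *)
Lemma higman_good : wqo le -> forall u, exists i j, (i < j)%N /\ emb (u i) (u j).
Proof.
move=> wle u0; apply: contrapT => nogood.
have bad0 : bad u0 by move=> i j ij e; apply: nogood; exists i, j.
(* One stage: among the bad sequences sharing the first [n] entries with a bad [v], pick one whose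
   entry [n] is shortest. *)
have step (vn : (nat -> seq A) * nat) : exists w, bad vn.1 ->
    [/\ bad w, agree vn.2 w vn.1
      & forall w', bad w' -> agree vn.2 w' vn.1 -> (size (w vn.2) <= size (w' vn.2))%N].
  case: vn => v n /=; have [bv|nbv] := pselect (bad v); last by exists v.
  have ex : exists m, `[< exists w, [/\ bad w, agree n w v & size (w n) = m] >].
    by exists (size (v n)); apply/asboolP; exists v.
  case: (ex_minnP ex) => m /asboolP[w [bw wv wm]] mmin.
  exists w => _; split=> // w' bw' w'v; rewrite wm; apply: mmin; apply/asboolP.
  by exists w'.
have [nx nxP] := choice step.
pose V := fix V n := if n is k.+1 then nx (V k, k) else u0.
have Vbad n : bad (V n) by elim: n => //= n /(nxP (_, n))[].
have Vagr n k : (n <= k)%N -> agree n (V k) (V n).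
  elim: k => [|k IHk]; first by rewrite leqn0 => /eqP->.
  rewrite leq_eqVlt => /orP[/eqP->//|]; rewrite ltnS => nk i ni.
  have [_ /= wk _] := nxP (V k, k) (Vbad k).
  by rewrite wk; [exact: IHk | exact: leq_trans nk].
(* Entry [n] is settled from stage [n.+1] on, so the diagonal is the limit; a good pair in it would
   already occur in some [V k]. *)
pose m n := V n.+1 n.
have mV n k : (n < k)%N -> m n = V k n by move=> nk; rewrite (Vagr n.+1).
have mbad : bad m.
  by move=> i j ij; rewrite (mV i j.+1 (ltnW ij)); apply: Vbad.
have mmin n w : bad w -> agree n w m -> (size (m n) <= size (w n))%N.
  move=> bw wm; have [_ _ /= hmin] := nxP (V n, n) (Vbad n); apply: hmin => // i ni.
  by rewrite wm // (mV i n).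
have m_cons n : exists aw : A * seq A, m n = aw.1 :: aw.2.
  case E : (m n) => [|a w]; last by exists (a, w).
  by case: (mbad n n.+1 (ltnSn n)); rewrite E; apply: emb_nil.
have [aw awE] := choice m_cons.
have [g gm gP] := wle (fun n => (aw n).1).
(* From position [g 0] on, entry [g 0 + k] is the tail of [m (g k)]. The heads increase along [g],
   so a good pair of tails would give one in [m]; yet entry [g 0] is now shorter than the
   minimum. *)
pose v n := if (n < g 0)%N then m n else (aw (g (n - g 0)%N)).2.
have bv : bad v.
  move=> i j ij; rewrite /v; case: ltnP => ig; case: ltnP => jg.
  - exact: mbad.
  - move=> e; have ij' : (i < g (j - g 0))%N.
      exact: leq_trans ig (smono_le gm (leq0n _)).
    by apply: (mbad i (g (j - g 0)%N) ij'); rewrite (awE (g _)); apply: emb_skip.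
  - by have := leq_trans (leq_ltn_trans ig ij) (ltnW jg); rewrite ltnn.
  - move=> e; have ij' : (i - g 0 < j - g 0)%N by lia.
    apply: (mbad _ _ (gm _ _ ij')); rewrite !awE; apply: emb_cons => //.
    exact: gP.
have vm : agree (g 0%N) v m by move=> i ig; rewrite /v ig.
by have := mmin _ _ bv vm; rewrite /v ltnn subnn {1}awE /= ltnn.
Qed.

Lemma higman : (forall x y z, le x y -> le y z -> le x z) -> wqo le -> wqo emb.
Proof.
by move=> letr wle; apply: good_wqo (emb_trans letr) (higman_good wle).
Qed.

End Higman.

                         

(** * Noetherian rings *)

(** The spans of the initial segments have an ideal as union; its finitely many generators all lie
    in one span, which therefore contains every later term. *)
Lemma noetherian_seq (K : comNzRingType) (a : nat -> K) : noetherian K ->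
  exists N (b : nat -> K), a N = \sum_(i < N) b i * a i.
Proof.
pose sp N x := exists b : nat -> K, x = \sum_(i < N) b i * a i.
have spW N M x : (N <= M)%N -> sp N x -> sp M x.
  move=> NM [b ->]; exists (fun i => if (i < N)%N then b i else 0).
  rewrite (big_ord_widen M (fun i => b i * a i)) // big_mkcond /=.
  by apply: eq_bigr => i _; case: ifP; rewrite ?mul0r.
have spD N x y : sp N x -> sp N y -> sp N (x + y).
  move=> [b ->] [c ->]; exists (fun i => b i + c i); rewrite -big_split /=.
  by apply: eq_bigr => i _; rewrite mulrDl.
have spM N c x : sp N x -> sp N (c * x).
  move=> [b ->]; exists (fun i => c * b i); rewrite mulr_sumr.
  by apply: eq_bigr => i _; rewrite mulrA.
have sp0 N : sp N 0.
  by exists (fun=> 0); rewrite big1 // => i _; rewrite mul0r.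
move=> /(_ (fun x => exists N, sp N x))[].
  split=> [|x y [N hN] [M hM]|c x [N hN]].
  - by exists 0%N.
  - by exists (maxn N M); apply: spD; [apply: spW hN|apply: spW hM]; lia.
  - by exists N; apply: spM.
move=> n [g gP].
have /choice[h hP] : forall i, exists N, sp N (g i).
  move=> i; apply/gP; exists (fun j => (j == i)%:R).
  rewrite (bigD1 i) //= eqxx mul1r big1 ?addr0 // => j /negPf->.
  by rewrite mul0r.
pose N := (\max_i h i)%N; exists N.
have /gP[c ->] : exists k, sp k (a N).
  exists N.+1, (fun i => (i == N)%:R).
  rewrite big_ord_recr /= eqxx mul1r big1 ?add0r // => j _.
  by rewrite ltn_eqF ?mul0r.
apply: (big_ind (sp N)) => [|x y|i _]; [exact: sp0 | exact: spD | apply: spM].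
by apply: spW (hP i); apply: leq_bigmax.
Qed.

                              

(** * Finitary permutations *)

Lemma swap_bij (a b : nat) :
  bijective (fun i => if i == a then b else if i == b then a else i).
Proof.
pose f i := if i == a then b else if i == b then a else i.
have fK : cancel f f.
  move=> i; rewrite /f; have [->|ia] := eqVneq i a.
    by rewrite eqxx; case: eqP.
  have [->|ib] := eqVneq i b; first by rewrite eqxx.
  by rewrite (negPf ia) (negPf ib).
by exists f.
Qed.

Lemma swap_fin (a b : nat) : exists s : seq nat, forall i,
  (if i == a then b else if i == b then a else i) <> i -> i \in s.
Proof.
exists [:: a; b] => i; rewrite !inE.
by case: eqP => //= _; case: eqP.
Qed.

Definition sym_swap (a b : nat) : Sym := MkSym (swap_bij a b) (swap_fin a b).

(** Induction on [n]: following [s] by the swap of [s n] and [f n] corrects the value at [n].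
    Earlier values differ from [s n] by injectivity of [s] and from [f n] by hypothesis, so they
    survive. *)
Lemma sym_extend n (f : nat -> nat) :
  (forall i j, (i < j < n)%N -> f i <> f j) ->
  exists s : Sym, forall i, (i < n)%N -> s i = f i.
Proof.
elim: n => [|n IHn] f_inj; first by exists sym_one.
have [|s sP] := IHn; first by move=> i j /andP[ij jn]; apply: f_inj; rewrite ij ltnW.
exists (sym_mul (sym_swap (s n) (f n)) s) => i /=.
rewrite ltnS leq_eqVlt => /orP[/eqP->|i_n]; first by rewrite eqxx.
have -> : (s i == s n) = false by rewrite (inj_eq (@sym_inj s)) ltn_eqF.
rewrite (sP _ i_n); case: eqP => // fE; case: (f_inj i n) => //.
by rewrite i_n ltnSn.
Qed.

(** * The action on monomials *)

Section MonomialAction.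
Variables (K : comNzRingType) (c : nat).
Local Notation P := (polyInf K c).
Local Notation mon := {cmonom ('I_c * nat)%type}.

Definition varmap (s : Sym) (v : 'I_c * nat) := (v.1, s v.2).

Lemma varmap_inj s : injective (varmap s).
Proof. by move=> [i j] [i' j'] [-> /sym_inj->]. Qed.

(** [monact] yields a ring element; this is the monomial underlying it, on which orders and degrees
    can be evaluated. *)
Definition monmap (s : Sym) (m : mon) : mon :=
  [cmonom m (v.1, sym_inv s v.2) | v in (varmap s @` finsupp m)%fset]%M.

Lemma monmapEV s m v : monmap s m v = m (v.1, sym_inv s v.2).
Proof.
rewrite /monmap cmE fsfunE; case: ifP => // /negbT /imfsetP nv.
apply/esym/eqP; rewrite cmE_eq0; apply/negP => vm; apply: nv.
exists (v.1, sym_inv s v.2) => //.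
by rewrite /varmap /= sym_inv_funK; case: (v).
Qed.

Lemma monmapE s m v : monmap s m (varmap s v) = m v.
Proof. by rewrite monmapEV /= sym_funK; case: v. Qed.

Lemma monmap_inj s : injective (monmap s).
Proof.
by move=> m n e; apply/eqP/cmP => v; rewrite -(monmapE s) e monmapE.
Qed.

Lemma monmapV s m : monmap s (monmap s^-1%g m) = m.
Proof.
by apply/eqP/cmP => -[i j]; rewrite !monmapEV /= sym_funK.
Qed.

Lemma finsupp_monmap s m : finsupp (monmap s m) = (varmap s @` finsupp m)%fset.
Proof.
apply/fsetP => v; rewrite -cmE_neq0 monmapEV cmE_neq0.
apply/idP/imfsetP => [vm|[w wm ->]]; last by rewrite /= sym_funK; case: w wm.
by exists (v.1, sym_inv s v.2) => //; rewrite /varmap /= sym_inv_funK; case: (v).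
Qed.

Lemma mdeg_monmap s m : mdeg (monmap s m) = mdeg m.
Proof.
rewrite !mdegE finsupp_monmap big_imfset /=; last by move=> ? ? _ _ /varmap_inj.
by apply: eq_bigr => v _; rewrite monmapE.
Qed.

Lemma polyactU s (a : K) m : polyact s (<< a *g m >> : P) = << a *g monmap s m >>.
Proof.
have -> : << a *g m >> = a *: << m >> :> P by rewrite scale_malgU mulr1.
have -> : << a *g monmap s m >> = a *: << monmap s m >> :> P.
  by rewrite scale_malgU mulr1.
rewrite polyactZ; congr (_ *: _); rewrite /polyact mmapU [LHS]mul1r.
rewrite [RHS]malgU_prod finsupp_monmap big_imfset /=; last first.
  by move=> ? ? _ _ /varmap_inj.
by apply: eq_bigr => v _; rewrite monmapE.
Qed.

Lemma poly_ind (Q : P -> Prop) : Q 0 -> (forall p q, Q p -> Q q -> Q (p + q)) ->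
  (forall a m, Q << a *g m >>) -> forall p, Q p.
Proof. by move=> Q0 QD QU p; rewrite (monalgE p); apply: big_ind. Qed.

Lemma polyact0 s : polyact s (0 : P) = 0.
Proof. exact: (raddf0 (polyact s)). Qed.

Lemma polyactD s (p q : P) : polyact s (p + q) = polyact s p + polyact s q.
Proof. exact: (raddfD (polyact s)). Qed.

Lemma mcoeff_polyact s (p : P) m : (polyact s p)@_(monmap s m) = p@_m.
Proof.
elim/poly_ind: p => [|p q IHp IHq|a n].
- by rewrite polyact0 [LHS]mcoeff0 [RHS]mcoeff0.
- by rewrite polyactD [LHS]mcoeffD [RHS]mcoeffD; congr (_ + _).
- by rewrite polyactU [LHS]mcoeffU [RHS]mcoeffU (inj_eq (@monmap_inj s)).
Qed.

Lemma mulUU (a b : K) (m n : mon) :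
  << a *g m >> * << b *g n >> = << a * b *g mmul m n >> :> P.
Proof. by rewrite [LHS]malgM_def fgmulUU. Qed.

Lemma mmul_inj (n : mon) : injective (mmul n).
Proof.
move=> m m' e; apply/eqP/cmP => v.
have : mmul n m v = mmul n m' v by rewrite e.
by rewrite !cmM => /addnI.
Qed.

Lemma mcoeff_monM (n m : mon) (p : P) : (<< n >> * p)@_(mmul n m) = p@_m.
Proof.
elim/poly_ind: p => [|p q IHp IHq|a m'].
- by rewrite mulr0 [LHS]mcoeff0 [RHS]mcoeff0.
- by rewrite mulrDr [LHS]mcoeffD [RHS]mcoeffD; congr (_ + _).
- by rewrite mulUU mul1r [LHS]mcoeffU [RHS]mcoeffU (inj_eq (@mmul_inj n)).
Qed.

Lemma mcoeff_monM_neq0 (n m : mon) (p : P) : (<< n >> * p)@_m != 0 ->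
  exists m', m = mmul n m'.
Proof.
move=> pm; apply: contrapT => nm; move/eqP: pm; apply.
elim/poly_ind: p => [|p q IHp IHq|a m'].
- by rewrite mulr0 [LHS]mcoeff0.
- rewrite mulrDr.
  rewrite [LHS]mcoeffD.
  rewrite [X in X + _]IHp.
  rewrite [X in _ + X]IHq.
  by rewrite addr0.
- rewrite mulUU mul1r [LHS]mcoeffU; case: eqP => // e.
  by case: nm; exists m'.
Qed.

Lemma fi_comp_inj d s : injective (@fi_comp d s).
Proof.
by move=> f g e; rewrite -(fi_comp1 f) -(fi_comp1 g) -(mulVg s) !fi_compM e.
Qed.

Lemma mcoeff_freeSym_act d s (x : freeSym K c d) f :
  (freeSym_act s x)@_(fi_comp s f) = polyact s x@_f.
Proof.
elim/freeSym_ind: x => [|x y IHx IHy|a g].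
- by rewrite freeSym_act0 [LHS]mcoeff0 [X in polyact s X]mcoeff0 polyact0.
- rewrite freeSym_actD [LHS]mcoeffD [X in polyact s X]mcoeffD polyactD.
  by congr (_ + _); [exact: IHx | exact: IHy].
- rewrite freeSym_actU [LHS]mcoeffU [X in _ = polyact s X]mcoeffU.
  by rewrite (inj_eq (@fi_comp_inj d s)); case: eqP => // _; rewrite polyact0.
Qed.

End MonomialAction.

(** * Finite generation by leading terms *)

Section SymSubmodules.
Variables (K : comNzRingType) (c : nat).
Local Notation P := (polyInf K c).
Implicit Types F G : symModType K c.

Definition gensub F (g : seq F) (x : F) : Prop :=
  forall N : set F, is_sym_submodule N -> (forall y, y \in g -> N y) -> N x.

Lemma gensub_submodule F (g : seq F) : is_sym_submodule (gensub g).
Proof.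
split=> [N hN _|x y hx hy N hN gN|a x hx N hN gN|s x hx N hN gN].
- exact: subm0.
- by apply: submD => //; [exact: hx | exact: hy].
- by apply: submZ => //; exact: hx.
- by apply: subm_act => //; exact: hx.
Qed.

Lemma gensub_mem F (g : seq F) x : x \in g -> gensub g x.
Proof. by move=> xg N _; apply. Qed.

Lemma gensub_sub F (g : seq F) (N : set F) : is_sym_submodule N ->
  (forall y, y \in g -> N y) -> forall x, gensub g x -> N x.
Proof. by move=> hN gN x; apply. Qed.

Lemma subm_sum F (N : set F) (I : Type) (s : seq I) (h : I -> F) :
  is_sym_submodule N -> (forall i, N (h i)) -> N (\sum_(i <- s) h i).
Proof. by move=> hN hs; apply: big_ind => // [|x y]; [exact: subm0|exact: submD]. Qed.

Lemma submN F (N : set F) x : is_sym_submodule N -> N x -> N (- x).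
Proof. by move=> hN Nx; rewrite -scaleN1r; apply: submZ. Qed.

Lemma submB F (N : set F) x y : is_sym_submodule N -> N x -> N y -> N (x - y).
Proof. by move=> hN Nx Ny; apply: submD => //; apply: submN. Qed.

Definition sym_noetherian F := forall M : set F, is_sym_submodule M ->
  exists2 g : seq F, (forall x, x \in g -> M x) & (forall x, M x -> gensub g x).

Section LeadingTerms.
Variables (G : symModType K c) (T : eqType) (coef : T -> G -> K).
Variables (lt dvd : T -> T -> Prop).

(** Only an upper bound: the coefficient at [t] itself may vanish, so the relation passes to
    combinations in which leading terms cancel. *)
Definition lead_le (x : G) t := forall u, coef u x != 0 -> u = t \/ lt u t.

Hypothesis K_noeth : noetherian K.
Hypothesis coefB : forall t x y, coef t (x - y) = coef t x - coef t y.
Hypothesis coefZ : forall t (a : K) x, coef t ((malgC a : P) *: x) = a * coef t x.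
Hypothesis coef_ext : forall x, (forall t, coef t x = 0) -> x = 0.
Hypothesis coef_fin :
  forall x, exists s : seq T, forall t, coef t x != 0 -> t \in s.
Hypothesis lt_trans : forall t u v, lt t u -> lt u v -> lt t v.
Hypothesis lt_total : forall t u, [\/ t = u, lt t u | lt u t].
Hypothesis lt_wf : well_founded lt.
Hypothesis dvd_wqo : wqo dvd.
Hypothesis dvd_shift : forall t u, dvd t u -> exists op : G -> G,
  (forall N x, is_sym_submodule N -> N x -> N (op x)) /\
  (forall x, lead_le x t -> coef u (op x) = coef t x /\ lead_le (op x) u).

Lemma lead_exists x : x != 0 -> exists2 t, coef t x != 0 & lead_le x t.
Proof.
move=> x0; have [t0 ct0] : exists t, coef t x != 0.
  apply: contrapT => nt; move/eqP: x0; apply; apply: coef_ext => t.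
  by apply: contrapT => ct; apply: nt; exists t; apply/eqP.
have [s sP] := coef_fin x.
have [t [ct ts tP]] : exists t, [/\ coef t x != 0, t \in s &
    forall u, u \in s -> coef u x != 0 -> u = t \/ lt u t].
  suff H (s' : seq T) : {subset s' <= s} -> exists t, [/\ coef t x != 0, t \in s &
    forall u, u \in s' -> coef u x != 0 -> u = t \/ lt u t] by exact: H.
  elim: s' => [_|v s' IH sub]; first by exists t0; split=> //; exact: sP.
  have [|t [ct ts tP]] := IH; first by move=> u us; apply: sub; rewrite inE us orbT.
  have [cv|cv] := eqVneq (coef v x) 0.
    exists t; split=> // u; rewrite inE => /predU1P[->|]; last exact: tP.
    by rewrite cv eqxx.
  have [tv|tv|tv] := lt_total t v.
  - exists t; split=> // u; rewrite inE => /predU1P[-> _|]; last exact: tP.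
    by left.
  - exists v; split=> // [|u]; first by apply: sub; rewrite inE eqxx.
    rewrite inE => /predU1P[-> _|us cu]; first by left.
    right; have [->//|ut] := tP u us cu; exact: lt_trans tv.
  - exists t; split=> // u; rewrite inE => /predU1P[-> _|]; last exact: tP.
    by right.
by exists t => // u cu; apply: tP => //; apply: sP.
Qed.

Lemma wf_min (Q : T -> Prop) t : Q t ->
  exists2 u, Q u & forall v, Q v -> ~ lt v u.
Proof.
elim/(well_founded_ind lt_wf): t => t IH Qt.
have [[v [Qv vt]]|nv] := pselect (exists v, Q v /\ lt v t); first exact: IH Qv.
by exists t => // v Qv vt; apply: nv; exists v.
Qed.

(* Successively pick elements outside the submodule generated so far, with
   minimal leading monomial.  Along a dvd-chain of leading monomials one leading
   coefficient is a combination of the earlier ones, so its monomial was not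
   minimal. *)
Lemma leading_noetherian : sym_noetherian G.
Proof.
have coef0 t : coef t 0 = 0 by rewrite -[0 in LHS]subr0 coefB subrr.
have coefD t x y : coef t (x + y) = coef t x + coef t y.
  by rewrite -[y in LHS]opprK -[- y in LHS]sub0r !coefB coef0 sub0r opprK.
move=> M hM; apply: contrapT => nog.
have pick (g : seq G) : exists x, (forall y, y \in g -> M y) ->
    [/\ M x, ~ gensub g x & exists t, lead_le x t /\ forall y u,
      M y -> ~ gensub g y -> lead_le y u -> ~ lt u t].
  have [gM|gM] := pselect (forall x, x \in g -> M x); last by exists 0.
  have [x0 Mx0 gx0] : exists2 x, M x & ~ gensub g x.
    apply: contrapT => nx; apply: nog; exists g => // x Mx.
    by apply: contrapT => gx; apply: nx; exists x.
  pose Q t := exists x, [/\ M x, ~ gensub g x & lead_le x t].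
  have [t0 _ lt0] : exists2 t, coef t x0 != 0 & lead_le x0 t.
    apply: lead_exists; apply/eqP => x00; apply: gx0; rewrite x00.
    exact: subm0 (gensub_submodule g).
  have [|t [x [Mx gx xt]] tmin] := @wf_min Q t0; first by exists x0.
  exists x => _; split=> //; exists t; split=> // y u My gy yu.
  by apply: tmin; exists y.
have [nx nxP] := choice pick.
pose g := fix g n := if n is k.+1 then nx (g k) :: g k else [::].
have gM n : forall x, x \in g n -> M x.
  elim: n => //= n IHn x; rewrite inE => /predU1P[->|]; last exact: IHn.
  by have [] := nxP (g n) IHn.
pose x n := nx (g n).
have xg i j : (i < j)%N -> x i \in g j.
  elim: j => // j IHj; rewrite ltnS leq_eqVlt /= inE => /predU1P[->|/IHj->].
    by rewrite eqxx.
  by rewrite orbT.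
have /choice[t tP] : forall n, exists t, lead_le (x n) t /\ forall y u,
    M y -> ~ gensub (g n) y -> lead_le y u -> ~ lt u t.
  by move=> n; have [_ _] := nxP (g n) (gM n).
have Mx n : M (x n) by have [] := nxP (g n) (gM n).
have xng n : ~ gensub (g n) (x n) by have [] := nxP (g n) (gM n).
have [h hm hP] := dvd_wqo t.
have [N [b aN]] := noetherian_seq (fun n => coef (t (h n)) (x (h n))) K_noeth.
have /choice[op opP] : forall i, exists op : G -> G, (i < N)%N ->
    (forall N x, is_sym_submodule N -> N x -> N (op x)) /\
    (forall x, lead_le x (t (h i)) ->
      coef (t (h N)) (op x) = coef (t (h i)) x /\ lead_le (op x) (t (h N))).
  move=> i; case: (ltnP i N) => [iN|_]; last by exists id.
  by have [op opP] := dvd_shift (hP _ _ iN); exists op.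
(* [S] combines shifts of earlier picks, hence lies in the submodule generated before stage [h N],
   and it has the same coefficient at [t (h N)] as [x (h N)]. *)
pose S := \sum_(i < N) (malgC (b i) : P) *: op i (x (h i)).
have coefS u : coef u S = \sum_(i < N) b i * coef u (op i (x (h i))).
  rewrite /S (big_morph (coef u) (coefD u) (coef0 u)).
  by apply: eq_bigr => i _; rewrite coefZ.
have gS : gensub (g (h N)) S.
  have gsub := gensub_submodule (g (h N)).
  apply: (subm_sum _ gsub) => i; apply: (submZ gsub).
  by have [opN _] := opP _ (ltn_ord i); apply: (opN _ _ gsub);
    exact: (gensub_mem (xg _ _ (hm _ _ (ltn_ord i)))).
have MS : M S by apply: gensub_sub gS => //; exact: gM.
pose y := x (h N) - S.
have gy : ~ gensub (g (h N)) y.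
  move=> gy; apply: (xng (h N)); rewrite -[x _](subrK S).
  exact: (submD (gensub_submodule _)).
have yt : lead_le y (t (h N)).
  move=> u; rewrite coefB coefS => cu.
  have [cx|cx] := eqVneq (coef u (x (h N))) 0; last first.
    exact: (proj1 (tP (h N)) u cx).
  apply: contrapT => nu; move/eqP: cu; apply; rewrite cx sub0r big1 ?oppr0 // => i _.
  have [opN /(_ (x (h i)) (proj1 (tP _)))[_ /(_ u)]] := opP _ (ltn_ord i).
  by case: eqVneq => [->|_ /(_ isT)//]; rewrite mulr0.
have [|u cu yu] := @lead_exists y.
  apply/eqP => y0; apply: gy; rewrite y0; exact: subm0 (gensub_submodule _).
(* A leading monomial of [y] strictly below [t (h N)] contradicts minimality; equality is excluded
   because the coefficients cancel there. *)
have [E|] := yt _ cu; last first.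
  by apply: (proj2 (tP (h N)) _ _ _ gy yu); exact: submB.
move/eqP: cu; apply; rewrite E coefB coefS aN; apply/eqP; rewrite subr_eq0.
apply/eqP/eq_bigr => i _; congr (_ * _).
by have [_ /(_ (x (h i)) (proj1 (tP _)))[-> _]] := opP _ (ltn_ord i).
Qed.

End LeadingTerms.
End SymSubmodules.

(** * Coordinates on finitely generated free modules *)

Section DirectSumInjection.
Variables (K : comNzRingType) (c : nat) (I : finType) (M : I -> symModType K c).
Local Notation P := (polyInf K c).

Definition ds_in i (m : M i) : dirsum M :=
  [ffun j => dfwith (fun j => 0 : M j) m j].

Lemma dsD (x y : dirsum M) i : (x + y) i = x i + y i.
Proof. exact: ffunE. Qed.
Lemma ds0 i : (0 : dirsum M) i = 0.
Proof. exact: ffunE. Qed.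
Lemma dsZ (a : P) (x : dirsum M) i : (a *: x) i = a *: x i.
Proof. exact: ffunE. Qed.
Lemma ds_symact s (x : dirsum M) i : symact s x i = symact s (x i).
Proof. exact: ffunE. Qed.

Lemma symact0 (F : symModType K c) s : symact s (0 : F) = 0.
Proof. by apply: (addrI (symact s 0)); rewrite -symactD !addr0. Qed.

Lemma ds_in_id i (m : M i) : ds_in m i = m.
Proof. by rewrite ffunE dfwith_in. Qed.

Lemma ds_in_out i (m : M i) j : i != j -> ds_in m j = 0.
Proof. by move=> ij; rewrite ffunE dfwith_out. Qed.

Lemma ds_in0 i : ds_in (0 : M i) = 0.
Proof.
apply/ffunP => j; rewrite ds0.
have [ij|ij] := eqVneq i j; last by rewrite ds_in_out.
by case: j / ij; rewrite ds_in_id.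
Qed.

Lemma ds_inD i (m m' : M i) : ds_in (m + m') = ds_in m + ds_in m'.
Proof.
apply/ffunP => j; rewrite dsD.
have [ij|ij] := eqVneq i j; last by rewrite !ds_in_out ?addr0.
by case: j / ij; rewrite !ds_in_id.
Qed.

Lemma ds_inZ i (a : P) (m : M i) : ds_in (a *: m) = a *: ds_in m.
Proof.
apply/ffunP => j; rewrite dsZ.
have [ij|ij] := eqVneq i j; last by rewrite !ds_in_out ?scaler0.
by case: j / ij; rewrite !ds_in_id.
Qed.

Lemma ds_in_act i s (m : M i) : ds_in (symact s m) = symact s (ds_in m).
Proof.
apply/ffunP => j; rewrite ds_symact.
have [ij|ij] := eqVneq i j; last by rewrite !ds_in_out ?symact0.
by case: j / ij; rewrite !ds_in_id.
Qed.

Lemma ds_sum (x : dirsum M) : x = \sum_i ds_in (x i).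
Proof.
have sumE (J : Type) (s : seq J) (h : J -> dirsum M) i :
    (\sum_(j <- s) h j) i = \sum_(j <- s) h j i.
  by apply: (big_morph (fun y : dirsum M => y i)) => [y z|]; rewrite ?dsD ?ds0.
apply/ffunP => i; rewrite sumE (bigD1 i) //= ds_in_id big1 ?addr0 // => j ji.
by rewrite ds_in_out.
Qed.

End DirectSumInjection.

Section FreeBasis.
Variables (K : comNzRingType) (c r : nat) (d : 'I_r -> nat).
Local Notation P := (polyInf K c).

Definition freeSum : symModType K c :=
  dirsum (fun i => freeSym K c (d i) : symModType K c).
Definition bidx : choiceType := {i : 'I_r & HomFI (d i)}.
Implicit Types (b : bidx) (x y : freeSum).

Definition bact s b : bidx := Tagged (fun i => HomFI (d i)) (fi_comp s (tagged b)).
Definition pcoef b x : P := (x (tag b))@_(tagged b).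
Definition bas b : freeSum :=
  ds_in (<< 1 *g tagged b >> : (freeSym K c (d (tag b)) : symModType K c)).

Lemma bact1 b : bact 1%g b = b.
Proof. by case: b => i f; rewrite /bact fi_comp1. Qed.

Lemma bactM s t b : bact (s * t)%g b = bact s (bact t b).
Proof. by case: b => i f; rewrite /bact /= fi_compM. Qed.

Lemma pcoef0 b : pcoef b 0 = 0.
Proof. by rewrite /pcoef [X in X@__]ds0 [LHS]mcoeff0. Qed.

Lemma pcoefD b x y : pcoef b (x + y) = pcoef b x + pcoef b y.
Proof. by rewrite /pcoef [X in X@__]dsD [LHS]mcoeffD. Qed.

Lemma pcoefZ b (a : P) x : pcoef b (a *: x) = a * pcoef b x.
Proof. by rewrite /pcoef [X in X@__]dsZ [LHS]mcoeffZ. Qed.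

Lemma pcoef_bas b b' : pcoef b (bas b') = (b' == b)%:R.
Proof.
rewrite /pcoef /bas; have [<-|bb'] := eqVneq b' b; first by rewrite ds_in_id [LHS]mcoeffUU.
case: b b' bb' => [i f] [i' f'] /= bb'.
have [ii'|ii'] := eqVneq i' i; last by rewrite ds_in_out ?[LHS]mcoeff0.
case: i / ii' f bb' => f bb'; rewrite ds_in_id [LHS]mcoeffU; case: eqP => // e.
by rewrite e eqxx in bb'.
Qed.

Lemma pcoef_act s b x : pcoef (bact s b) (symact s x) = polyact s (pcoef b x).
Proof. by rewrite /pcoef [X in X@__]ds_symact; exact: mcoeff_freeSym_act. Qed.

Lemma pcoef_ext x y : (forall b, pcoef b x = pcoef b y) -> x = y.
Proof.
by move=> xy; apply/ffunP => i; apply/malgP => f; have := xy (Tagged (fun i => HomFI (d i)) f).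
Qed.

Lemma bas_act s b : symact s (bas b) = bas (bact s b).
Proof.
rewrite /bas -ds_in_act; congr ds_in; rewrite [LHS]freeSym_actU.
by congr << _ *g _ >>; exact: (rmorph1 (polyact s)).
Qed.

Lemma free_ind (Q : freeSum -> Prop) : Q 0 ->
  (forall x y, Q x -> Q y -> Q (x + y)) -> (forall a b, Q (a *: bas b)) ->
  forall x, Q x.
Proof.
move=> Q0 QD QU x; rewrite [x]ds_sum; apply: big_ind => // i _.
elim/freeSym_ind: (x i) => [|y z Qy Qz|a f]; first by rewrite ds_in0.
  by rewrite ds_inD; apply: QD.
have := QU a (Tagged (fun i => HomFI (d i)) f); rewrite /bas -ds_inZ /=.
by rewrite scale_malgU mulr1.
Qed.

End FreeBasis.

(** * The monomial order *)

(** The largest index is the most significant. With the smallest one in that role, unit vectors at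
    growing indices would descend forever. *)
Definition revlex (g h : nat -> nat) :=
  exists2 k, (g k < h k)%N & forall k', (k < k')%N -> g k' = h k'.

Lemma revlex_trans g h l : revlex g h -> revlex h l -> revlex g l.
Proof.
move=> [k gh ghk] [k' hl hlk]; exists (maxn k k') => [|n nk].
  case: (ltngtP k k') => [kk|kk|kk]; first by rewrite ghk.
    by rewrite -(hlk _ kk).
  by rewrite -kk in hl; exact: ltn_trans hl.
by rewrite ghk ?hlk //; lia.
Qed.

Lemma revlex_total g h N : (forall k, (N <= k)%N -> g k = 0%N) ->
  (forall k, (N <= k)%N -> h k = 0%N) -> [\/ g =1 h, revlex g h | revlex h g].
Proof.
move=> gN hN; have [ex|nex] := pselect (exists k, g k != h k); last first.
  constructor 1 => k; apply/eqP; apply: contrapT => /negP kk; apply: nex.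
  by exists k.
have [k kN|k gk kmax] := @ex_maxnP _ N ex.
  by rewrite leqNgt; apply: contra kN => /ltnW Nk; rewrite gN ?hN.
have e k' : (k < k')%N -> g k' = h k'.
  by move=> kk'; apply/eqP; apply: contraLR kk' => /kmax; rewrite -leqNgt.
case: (ltngtP (g k) (h k)) gk => // lt _; first by constructor 2; exists k.
by constructor 3; exists k => // k' /e.
Qed.

Lemma revlex_supp g h N : revlex g h -> (forall k, (N <= k)%N -> h k = 0%N) ->
  forall k, (N <= k)%N -> g k = 0%N.
Proof.
move=> [k gh ghk] hN n Nn; case: (ltnP k n) => [/ghk->|nk]; first exact: hN.
by move: gh; rewrite hN // (leq_trans Nn).
Qed.

(** Three nested inductions: on the bound [N] of the support, on the top value [h N], and on the
    accessibility of the truncation of [h] below [N]. A smaller function either lowers the top value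
    or keeps it and lowers the truncation. *)
Lemma revlex_acc N h : (forall k, (N <= k)%N -> h k = 0%N) -> Acc revlex h.
Proof.
elim: N h => [|N IHN] h hN; first by constructor=> g [k]; rewrite hN.
move hv: (h N) => v; elim/ltn_ind: v h hN hv => v IHv.
pose tr (g : nat -> nat) k := if (k < N)%N then g k else 0%N.
move=> h hN hv; have : Acc revlex (tr h).
  by apply: IHN => k; rewrite /tr ltnNge => ->.
move: {-1}(tr h) (erefl (tr h)) => h0 + acc.
elim: acc h hN hv => {}h0 _ IH h hN hv h0E; constructor=> g gh.
have gN := revlex_supp gh hN; case: gh => k gk e.
have kN : (k <= N)%N by rewrite leqNgt; apply/negP => /hN hk; rewrite hk in gk.
move: kN; rewrite leq_eqVlt => /orP[/eqP kN|kN].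
  by apply: (IHv (g N)) => //; rewrite -hv -kN.
apply: (IH (tr g)) => //; last by rewrite e.
rewrite -h0E; exists k => [|k' kk']; first by rewrite /tr kN.
by rewrite /tr e.
Qed.

(** * Monomials of a free module, their columns and their order *)

Section FreeMonomials.
Variables (K : comNzRingType) (c r : nat) (d : 'I_r -> nat).
Local Notation P := (polyInf K c).
Local Notation mon := {cmonom ('I_c * nat)%type}.
Local Notation G := (freeSum K c d).

Definition fmon : eqType := (bidx d * mon)%type.
Implicit Types (t u : fmon) (x y : G) (s : Sym) (n : mon).

Definition coef t x : K := (pcoef t.1 x)@_t.2.
Definition tact s t : fmon := (bact s t.1, monmap s t.2).
Definition tmul n t : fmon := (t.1, mmul n t.2).

Lemma coefD t x y : coef t (x + y) = coef t x + coef t y.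
Proof. by rewrite /coef [X in X@__]pcoefD [LHS]mcoeffD. Qed.

Lemma coef0 t : coef t 0 = 0.
Proof. by rewrite /coef [X in X@__]pcoef0 [LHS]mcoeff0. Qed.

Lemma coefB t x y : coef t (x - y) = coef t x - coef t y.
Proof.
by apply/eqP; rewrite eq_sym subr_eq; apply/eqP; rewrite -coefD subrK.
Qed.

Lemma coefZ t (a : K) x : coef t ((malgC a : P) *: x) = a * coef t x.
Proof. by rewrite /coef [X in X@__]pcoefZ [X in X@__]mul_malgC [LHS]mcoeffZ. Qed.

Lemma coef_ext x : (forall t, coef t x = 0) -> x = 0.
Proof.
move=> x0; apply: pcoef_ext => b; rewrite pcoef0; apply/malgP => m.
by rewrite [RHS]mcoeff0; exact: (x0 (b, m)).
Qed.

Lemma coef_fin x : exists s : seq fmon, forall t, coef t x != 0 -> t \in s.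
Proof.
elim/free_ind: x => [|x y [s1 h1] [s2 h2]|a b].
- by exists [::] => t; rewrite coef0 eqxx.
- exists (s1 ++ s2) => t; rewrite coefD mem_cat => cxy.
  have [cx|/h1->//] := eqVneq (coef t x) 0.
  by rewrite h2 ?orbT //; rewrite cx add0r in cxy.
- exists [seq ((b, m) : fmon) | m <- enum_fset (msupp a)] => -[b' m].
  rewrite /coef [X in X@__]pcoefZ [X in _ * X]pcoef_bas /=.
  have [<-|bb'] := eqVneq b b'; last by rewrite mulr0 [X in X != 0]mcoeff0 eqxx.
  by rewrite mulr1 => am; apply/mapP; exists m => //; rewrite -mcoeff_neq0.
Qed.

Lemma coef_tact s t x : coef (tact s t) (symact s x) = coef t x.
Proof. by rewrite /coef [X in X@__]pcoef_act; exact: mcoeff_polyact. Qed.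

Lemma tactV s t : tact s (tact s^-1%g t) = t.
Proof. by case: t => b m; rewrite /tact /= monmapV -bactM mulgV bact1. Qed.

Lemma coef_tmul n t x : coef (tmul n t) ((<< n >> : P) *: x) = coef t x.
Proof. by rewrite /coef [X in X@__]pcoefZ; exact: mcoeff_monM. Qed.

Lemma coef_tmul_neq0 n t x : coef t ((<< n >> : P) *: x) != 0 ->
  exists u, t = tmul n u.
Proof.
rewrite /coef [X in X@__]pcoefZ => /mcoeff_monM_neq0[m tm].
by exists (t.1, m); rewrite [t]surjective_pairing tm.
Qed.

(* Column j of a monomial: rows a < c hold the exponents of the x_(a,j), and row
   c + l tells whether the l-th value of the injection indexing the basis vector
   is j.  Comparing columns entrywise thus also controls the injection. *)
Definition expo (m : mon) (j a : nat) : nat :=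
  if insub a is Some i then m (i, j) else 0%N.
Definition mark (b : bidx d) (j a : nat) : nat :=
  [exists l : 'I_(d (tag b)), (c + l == a)%N && (val (tagged b) l == j)].
Definition col t j a : nat := (expo t.2 j a + mark t.1 j a)%N.
(** The successor keeps the height positive even without variables, as needed for division with
    remainder in [tcode]. *)
Definition height : nat := (c + \max_i d i).+1.

Lemma col_expo t j (i : 'I_c) : col t j i = t.2 (i, j).
Proof.
rewrite /col /expo /mark valK; case: existsP => [[l /andP[/eqP e _]]|_];
  last exact: addn0.
by have := ltn_ord i; rewrite -e ltnNge leq_addr.
Qed.

Lemma col_mark t j (l : 'I_(d (tag t.1))) : col t j (c + l)%N = (val (tagged t.1) l == j).
Proof.
rewrite /col /expo insubN -?leqNgt ?leq_addr // add0n /mark; congr nat_of_bool.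
apply/existsP/eqP => [[k /andP[/eqP/addnI/ord_inj-> /eqP]//]|<-].
by exists l; rewrite !eqxx.
Qed.

Lemma col_tact s t j a : col (tact s t) (s j) a = col t j a.
Proof.
rewrite /col; congr (_ + _)%N; rewrite /expo /mark /=.
  by case: insub => // i; exact: (monmapE s _ (i, j)).
congr nat_of_bool; apply: eq_existsb => l; rewrite ffunE.
by rewrite (inj_eq (@sym_inj s)).
Qed.

Lemma col_tmul n t j a : col (tmul n t) j a = (expo n j a + col t j a)%N.
Proof.
by rewrite /col addnA; congr (_ + _)%N; rewrite /expo; case: insub => //= i; rewrite cmM.
Qed.

Lemma col_width t : exists N, forall j a, (N <= j)%N -> col t j a = 0%N.
Proof.
case: t => b m.
pose W := \max_(v <- finsupp m) v.2.+1; pose W' := \max_l (val (tagged b) l).+1.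
exists (W + W')%N => j a Nj; rewrite /col /expo /mark /=.
case: existsP => [[l /andP[_ /eqP fl]]|_].
  have : ((val (tagged b) l).+1 <= W')%N by exact: leq_bigmax.
  by rewrite fl; lia.
rewrite addn0; case: insub => // i; apply/eqP; rewrite cmE_eq0; apply/negP => vm.
have : (j.+1 <= W)%N by exact: (leq_bigmax_seq (i, j) vm).
lia.
Qed.

(** Row [c + l] is nonzero exactly in the column that is the [l]-th value of the injection, so the
    columns recover the injection. They do not reveal the summand, hence the first hypothesis. *)
Lemma fmon_ext t u : tag t.1 = tag u.1 ->
  (forall j a, (a < height)%N -> col t j a = col u j a) -> t = u.
Proof.
case: t u => [[i f] m] [[i' f'] m'] /= ii'; case: i' / ii' f' => f' e.
congr (_, _); last first.
  apply/eqP/cmP => -[a j]; have := e j a; rewrite !col_expo; apply.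
  by rewrite /height; have := ltn_ord a; lia.
congr Tagged; apply/val_inj/ffunP => l.
have lh : (c + l < height)%N.
  rewrite /height ltnS leq_add2l; apply: leq_trans (ltnW (ltn_ord l)) _.
  exact: leq_bigmax.
by have := e (val f' l) (c + l)%N lh; rewrite !col_mark eqxx; case: eqP.
Qed.

(* The columns read off in a row, the top column being the most significant one;
   entry 0 holds the index of the summand. *)
Definition tcode t k : nat :=
  if k is k'.+1 then col t (k' %/ height) (k' %% height) else tag t.1.

Definition tlt t u := revlex (tcode t) (tcode u).

Lemma tcode_supp t N : (forall j a, (N <= j)%N -> col t j a = 0%N) ->
  forall k, ((N * height).+1 <= k)%N -> tcode t k = 0%N.
Proof. by move=> tN [|k] //; rewrite ltnS => Nk; apply: tN; rewrite leq_divRL. Qed.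

Lemma tcode_inj t u : tcode t =1 tcode u -> t = u.
Proof.
move=> e; apply: fmon_ext => [|j a ah]; first by apply: val_inj; exact: (e 0%N).
have := e (j * height + a).+1; rewrite /= modnMDl modn_small //.
by rewrite divnMDl // divn_small // addn0.
Qed.

Lemma tlt_total t u : [\/ t = u, tlt t u | tlt u t].
Proof.
have [[N tN] [M uM]] := (col_width t, col_width u).
have [k kN|k kM|/tcode_inj->|?|?] :=
  @revlex_total (tcode t) (tcode u) (maxn N M * height).+1.
- by apply: (tcode_supp tN); nia.
- by apply: (tcode_supp uM); nia.
- by constructor 1.
- by constructor 2.
- by constructor 3.
Qed.

Lemma tlt_wf : well_founded tlt.
Proof.
move=> t; have [N tN] := col_width t; have := revlex_acc (tcode_supp tN).
move: {-1}(tcode t) (erefl (tcode t)) => h + acc.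
elim: acc t {N tN} => {}h _ IH t th; constructor=> u ut.
by apply: (IH (tcode u)) => //; rewrite -th.
Qed.

Lemma tlt_tmul n t u : tlt t u -> tlt (tmul n t) (tmul n u).
Proof.
have codeE v : tcode (tmul n v) = fun k => ((if k is k'.+1 then
    expo n (k' %/ height) (k' %% height) else 0%N) + tcode v k)%N.
  by apply/funext => -[|k] //=; rewrite col_tmul.
by move=> [k tu e]; exists k => [|k' /e]; rewrite !codeE ?ltn_add2l // => ->.
Qed.

(** Let [j] be the column of the highest disagreement. A column of the images beyond [s j] comes
    either from a column at or above [N], where both monomials vanish, or from some [j'] below [N]
    with [s j < s j']. Then [j < j'] by monotonicity, and there [t] and [u] agree. *)
Lemma tlt_tact s t u N : (forall j a, (N <= j)%N -> col u j a = 0%N) ->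
  (forall i j, (i < j < N)%N -> (s i < s j)%N) -> tlt t u ->
  tlt (tact s t) (tact s u).
Proof.
move=> uN sN tu; have tN := revlex_supp tu (tcode_supp uN).
have colV v j a : col (tact s v) j a = col v (sym_inv s j) a.
  by rewrite -{1}(sym_inv_funK s j) col_tact.
have colE v j a : (a < height)%N -> col v j a = tcode v (j * height + a).+1.
  by move=> ah; rewrite /= modnMDl modn_small // divnMDl // divn_small // addn0.
have sV j a k' : (a < height)%N -> (forall k, (k' < k)%N -> tcode t k = tcode u k) ->
    (sym_inv s j < N -> k' < (sym_inv s j * height + a).+1)%N ->
  col (tact s t) j a = col (tact s u) j a.
  move=> ah e; rewrite !colV; case: (ltnP (sym_inv s j) N) => [_ /(_ isT) kk|jN _].
    by rewrite !colE // e.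
  by rewrite uN // colE // tN // ltnS; nia.
(* Code position 0 is the least significant: a highest disagreement there means that only the
   summands differ. *)
case: tu => -[|k] /= tu e.
  exists 0%N => //= -[|k] // _ /=; apply: sV e _ => //.
  exact: ltn_pmod.
pose j := (k %/ height)%N; pose a := (k %% height)%N.
have ah : (a < height)%N by exact: ltn_pmod.
have kE : k = (j * height + a)%N by exact: divn_eq.
have jN : (j < N)%N by rewrite ltnNge; apply/negP => /uN uj; rewrite uj in tu.
exists (s j * height + a).+1 => [|[//|k' kk'] /=].
  by rewrite -!colE // !col_tact.
apply: sV e _; first exact: ltn_pmod.
rewrite ltnS in kk'; rewrite ltnS {1}kE.
set j' := sym_inv s _ => j'N; rewrite (divn_eq k' height) in kk'.
have sj' : s j' = (k' %/ height)%N by exact: sym_inv_funK.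
have a'h : (k' %% height < height)%N by exact: ltn_pmod.
rewrite -sj' in kk'.
case: (ltngtP j j') => jj'; first by nia.
  have := sN j' j; rewrite jj' jN => /(_ isT); nia.
by rewrite -jj' in kk' *; lia.
Qed.

End FreeMonomials.

(** * Divisibility of monomials *)

Section FreeNoetherian.
Variables (K : comNzRingType) (c r : nat) (d : 'I_r -> nat).
Local Notation P := (polyInf K c).
Local Notation mon := {cmonom ('I_c * nat)%type}.
Local Notation G := (freeSum K c d).
Local Notation fmon := (fmon c d).
Local Notation height := (height c d).
Implicit Types (t u : fmon).

Definition width t : nat := projT1 (cid (col_width t)).

Lemma widthP t j a : (width t <= j)%N -> col t j a = 0%N.
Proof. by rewrite /width; case: cid => N /= tN; exact: tN. Qed.

Definition tword t : seq (nat -> nat) := [seq col t j | j <- iota 0 (width t)].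

Lemma nth_tword t j : (j < width t)%N -> nth (fun=> 0%N) (tword t) j = col t j.
Proof. by move=> jt; rewrite (nth_map 0%N) ?size_iota // nth_iota. Qed.

Definition col_le (x y : nat -> nat) := forall a, (a < height)%N -> (x a <= y a)%N.

(* The first two inequalities encode equality of the summands as a
   well-quasi-order. *)
Definition tdvd t u := ((tag t.1 <= tag u.1)%N /\ (r - tag t.1 <= r - tag u.1)%N) /\
  emb col_le (tword t) (tword u).

Lemma tdvd_wqo : wqo tdvd.
Proof.
apply: wqo_and; first apply: wqo_and.
- exact: (wqo_comp (fun t => nat_of_ord (tag t.1)) wqo_nat).
- exact: (wqo_comp (fun t => (r - tag t.1)%N) wqo_nat).
- apply: (wqo_comp tword); apply: higman; last exact: dickson.
  by move=> x y z xy yz a ah; exact: leq_trans (xy a ah) (yz a ah).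
Qed.

(** The column map of the embedding extends to a permutation [s]. In the marking rows the inequality
    reads 1 <= 1 at each value of the injection, which forces the two basis vectors to correspond
    under [s]; in the exponent rows it is divisibility, with quotient [n]. *)
Lemma tdvd_factor t u : tdvd t u -> exists (s : Sym) (n : mon),
  (forall i j, (i < j < width t)%N -> (s i < s j)%N) /\ u = tmul n (tact s t).
Proof.
move=> [[tu1 tu2] /(emb_smono (fun=> 0%N))[f]].
rewrite !size_map !size_iota => -[f_u f_mono f_le].
have tu : tag t.1 = tag u.1.
  by apply: ord_inj; have := ltn_ord (tag t.1); have := ltn_ord (tag u.1); lia.
have [|s sf] := @sym_extend (width t) f.
  by move=> i j ij e; have := f_mono i j ij; rewrite e ltnn.
have s_le j a : (a < height)%N -> (col t j a <= col u (s j) a)%N.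
  move=> ah; have [jt|jt] := ltnP j (width t); last by rewrite widthP.
  have := f_le j jt; rewrite !nth_tword // ?f_u // => /(_ a ah).
  by rewrite sf.
exists s, (divcm u.2 (monmap s t.2)); split.
  move=> i j ij; rewrite !sf; [exact: f_mono | by case/andP: ij |].
  by case/andP: ij => /ltn_trans; apply.
have le_m v : (monmap s t.2 v <= u.2 v)%N.
  case: v => i j; rewrite -(sym_inv_funK s j) (monmapE s t.2 (i, _)).
  by rewrite -!col_expo; apply: s_le; rewrite /height; have := ltn_ord i; lia.
case: t u tu s_le le_m {f f_u f_mono f_le sf tu1 tu2} => [[i f] m] [[i' f'] m'] /=.
move=> ii'; case: i' / ii' f' => f' s_le le_m; congr (_, _).
  congr Tagged; apply/val_inj/ffunP => l; rewrite ffunE.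
  have lh : (c + l < height)%N.
    rewrite /height ltnS leq_add2l; apply: leq_trans (ltnW (ltn_ord l)) _.
    exact: leq_bigmax.
  have := s_le (val f l) _ lh; rewrite !col_mark eqxx.
  by case: eqP.
by apply/eqP/cmP => v; rewrite cmM divcmE subnK.
Qed.

Lemma tdvd_shift t u : tdvd t u -> exists op : G -> G,
  (forall N x, is_sym_submodule N -> N x -> N (op x)) /\
  (forall x, lead_le (@coef K c r d) (@tlt c r d) x t ->
     coef u (op x) = coef t x /\ lead_le (@coef K c r d) (@tlt c r d) (op x) u).
Proof.
move=> /tdvd_factor[s [n [s_mono ->]]].
exists (fun x => (<< n >> : P) *: symact s x); split.
  by move=> N x hN Nx; apply: submZ => //; exact: subm_act.
move=> x xt; rewrite coef_tmul coef_tact; split=> // v cv.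
(* Each monomial of [op x] arises by [s] and multiplication by [n] from a monomial of [x], which is
   at most [t]. *)
have [w vw] := coef_tmul_neq0 cv; subst v.
rewrite coef_tmul -(tactV s w) coef_tact in cv.
rewrite -(tactV s w); have [->|wt] := xt _ cv; first by left.
right; apply: tlt_tmul; apply: tlt_tact s_mono wt => j a; exact: widthP.
Qed.

Lemma freeSum_noetherian : noetherian K -> sym_noetherian G.
Proof.
move=> K_noeth.
apply: (@leading_noetherian _ _ _ _ (@coef K c r d) (@tlt c r d) tdvd).
- exact: K_noeth.
- exact: coefB.
- exact: coefZ.
- exact: coef_ext.
- exact: coef_fin.
- by move=> t u v; exact: revlex_trans.
- exact: tlt_total.
- exact: tlt_wf.
- exact: tdvd_wqo.
- exact: tdvd_shift.
Qed.

End FreeNoetherian.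

(** * Elements fixed by all permutations of the far columns *)

Section FiniteWidth.
Variables (K : comNzRingType) (c : nat).

Definition fixed_from (F : symModType K c) (x : F) n :=
  forall s : Sym, (forall j, (j < n)%N -> s j = j) -> symact s x = x.

Definition fin_width (F : symModType K c) := forall x : F, exists n, fixed_from x n.

Lemma freeSum_fin_width r (d : 'I_r -> nat) : fin_width (freeSum K c d).
Proof.
elim/free_ind => [|x y [n hn] [m hm]|p b].
- by exists 0%N => s _; rewrite symact0.
- exists (maxn n m) => s hs; rewrite symactD hn ?hm // => j jm; apply: hs; lia.
- have [n hn] : exists n, forall s : Sym, (forall j, (j < n)%N -> s j = j) ->
      polyact s p = p.
    elim/poly_ind: p => [|p q [n hn] [m hm]|a m].
    - by exists 0%N => s _; rewrite polyact0.
    - exists (maxn n m) => s hs; rewrite polyactD hn ?hm // => j jm; apply: hs; lia.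
    - exists (\max_(v <- finsupp m) v.2.+1) => s hs; rewrite polyactU.
      suff -> : monmap s m = m by [].
      apply/eqP/cmP => v.
      have sv w : w \in finsupp m -> varmap s w = w.
        move=> wm; rewrite /varmap hs; first by case: (w).
        exact: (leq_bigmax_seq w wm).
      have [vm|vm] := boolP (v \in finsupp m); first by rewrite -{1}(sv _ vm) monmapE.
      have vsm : v \notin finsupp (monmap s m).
        rewrite finsupp_monmap; apply/imfsetP => -[w /= wm vw].
        by move: vm; rewrite vw sv ?wm.
      by move: vm vsm; rewrite -!cmE_eq0 => /eqP-> /eqP->.
  pose W := \max_l (val (tagged b) l).+1.
  have fW l : (val (tagged b) l < W)%N by exact: leq_bigmax.
  exists (n + W)%N => s hs.
  rewrite symactZ bas_act hn; last by move=> j jn; apply: hs; lia.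
  congr (_ *: bas _ _ _); rewrite /bact; suff -> : fi_comp s (tagged b) = tagged b.
    by case: (b).
  by apply/val_inj/ffunP => l; rewrite ffunE hs // ltn_addl.
Qed.

End FiniteWidth.

(** * Free covers *)

Section MalgLift.
Variables (R : comNzRingType) (I : choiceType) (V : lmodType R) (v : I -> V).

Definition malg_lift (a : {malg R[I]}) : V := \sum_(i <- msupp a) a@_i *: v i.

Lemma malg_liftEw a (D : {fset I}) : (msupp a `<=` D)%fset ->
  malg_lift a = \sum_(i <- D) a@_i *: v i.
Proof.
move=> le; rewrite /malg_lift (big_fset_incl _ le) //= => f _ /mcoeff_outdom ->.
by rewrite scale0r.
Qed.

Lemma malg_liftD a b : malg_lift (a + b) = malg_lift a + malg_lift b.
Proof.
rewrite (malg_liftEw (msuppD_le a b)).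
rewrite (malg_liftEw (fsubsetUl (msupp a) (msupp b))).
rewrite (malg_liftEw (fsubsetUr (msupp a) (msupp b))) -big_split /=.
by apply: eq_bigr => i _; rewrite mcoeffD scalerDl.
Qed.

Lemma malg_liftZ (p : R) a : malg_lift (p *: a) = p *: malg_lift a.
Proof.
rewrite (malg_liftEw (msuppZ_le p a)) /malg_lift scaler_sumr.
by apply: eq_bigr => f _; rewrite mcoeffZ scalerA.
Qed.

Lemma malg_liftU (p : R) i : malg_lift << p *g i >> = p *: v i.
Proof. by rewrite (malg_liftEw msuppU_le) big_seq_fset1 mcoeffUU. Qed.

Lemma malg_lift0 : malg_lift 0 = 0.
Proof. by rewrite /malg_lift msupp0 big_seq_fset0. Qed.

End MalgLift.

Section FreeLift.
Variables (K : comNzRingType) (c r : nat) (d : 'I_r -> nat).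
Local Notation P := (polyInf K c).
Local Notation G := (freeSum K c d).
Variables (F : symModType K c) (v : bidx d -> F).

Definition free_lift (x : G) : F :=
  \sum_i malg_lift (fun f => v (Tagged (fun i => HomFI (d i)) f)) (x i).

Fact free_lift_linear : linear free_lift.
Proof.
move=> a x y; rewrite /free_lift scaler_sumr -big_split /=.
apply: eq_bigr => i _; rewrite -malg_liftZ -malg_liftD; congr malg_lift.
by rewrite [LHS]dsD [X in X + _ = _]dsZ.
Qed.
HB.instance Definition _ :=
  GRing.isLinear.Build P G F *:%R free_lift free_lift_linear.

Lemma free_lift0 : free_lift 0 = 0.
Proof. exact: raddf0. Qed.
Lemma free_liftD x y : free_lift (x + y) = free_lift x + free_lift y.
Proof. exact: raddfD. Qed.
Lemma free_liftZ (a : P) x : free_lift (a *: x) = a *: free_lift x.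
Proof. exact: linearZ. Qed.

Lemma free_lift_bas b : free_lift (bas K c b) = v b.
Proof.
rewrite /free_lift (bigD1 (tag b)) //= [X in malg_lift _ X]ds_in_id malg_liftU scale1r.
rewrite big1 => [|i ib]; last first.
  by rewrite [X in malg_lift _ X]ds_in_out ?malg_lift0 1?eq_sym.
by rewrite addr0; case: b.
Qed.

Lemma free_lift_equivariant :
  (forall s b, v (bact s b) = symact s (v b)) -> equivariant free_lift.
Proof.
move=> vE s x; elim/free_ind: x => [|x y IHx IHy|a b].
- by rewrite symact0 free_lift0 symact0.
- rewrite symactD [LHS]free_liftD [X in _ = symact s X]free_liftD [RHS]symactD.
  by congr (_ + _); [exact: IHx | exact: IHy].
- rewrite symactZ [LHS]free_liftZ [X in _ = symact s X]free_liftZ [RHS]symactZ bas_act.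
  by rewrite [X in _ *: X = _]free_lift_bas [X in _ = _ *: symact s X]free_lift_bas vE.
Qed.

Lemma free_lift_sub (N : set F) : is_sym_submodule N -> (forall b, N (v b)) ->
  forall x, N (free_lift x).
Proof.
move=> hN Nv; elim/free_ind => [|x y|a b]; first by rewrite free_lift0; exact: subm0.
  by rewrite free_liftD; exact: submD.
by rewrite free_liftZ free_lift_bas; exact: submZ.
Qed.

End FreeLift.

(** * Generators, stabilisers and bases of free modules *)

Section FreeGenerators.
Variables (K : comNzRingType) (c r : nat) (d : 'I_r -> nat).
Local Notation P := (polyInf K c).
Local Notation G := (freeSum K c d).
Implicit Types (b : bidx d).

Program Definition fi_id n : HomFI n := exist _ [ffun l : 'I_n => nat_of_ord l] _.
Next Obligation. by apply/injectiveP => i j; rewrite !ffunE => /ord_inj. Qed.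

Definition bid i : bidx d := Tagged (fun i => HomFI (d i)) (fi_id (d i)).

(** [bid i] is the inclusion of the first [d i] columns, so its translate by [s] records the values
    of [s] there and nothing else. *)
Lemma bact_bid s t i : bact s (bid i) = bact t (bid i) <->
  forall j, (j < d i)%N -> s j = t j.
Proof.
split=> [e j ji|st].
  have /(congr1 (fun f : HomFI (d i) => val f (Ordinal ji))) :
      fi_comp s (fi_id (d i)) = fi_comp t (fi_id (d i)).
    by move: e => /eqP; rewrite eq_Tagged => /eqP.
  by rewrite /= !ffunE.
by congr Tagged; apply/val_inj/ffunP => l; rewrite !ffunE st.
Qed.

(** The basis vectors of one summand form a single orbit, because an injection of finitely many
    columns extends to a finitary permutation. *)
Lemma bact_ext b : exists s : Sym, bact s (bid (tag b)) = b.
Proof.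
case: b => i f /=.
have /injectiveP f_inj := valP f.
have [|s sP] := @sym_extend (d i) (fun j => if insub j is Some l then val f l else 0%N).
  move=> j k /andP[jk ki]; have ji := ltn_trans jk ki.
  by rewrite !insubT /= => /f_inj[] e; rewrite e ltnn in jk.
exists s; congr Tagged; apply/val_inj/ffunP => l.
by rewrite !ffunE sP // valK.
Qed.

Lemma free_generated (N : set G) : is_sym_submodule N ->
  (forall i, N (bas K c (bid i))) -> forall x, N x.
Proof.
move=> hN Nb; elim/free_ind => [|x y|a b]; [exact: subm0|exact: submD|].
have [s <-] := bact_ext b; rewrite -bas_act; apply: submZ => //.
exact: subm_act.
Qed.

Lemma freeSum_fin_gen : sym_fin_gen G.
Proof.
exists [seq bas K c (bid i) | i : 'I_r] => N hN Nb; apply: free_generated => // i.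
by apply: Nb; apply/mapP; exists i; rewrite ?mem_enum.
Qed.

(** The coordinates [pcoef b] are dual to [bas], so they read the coefficients off a combination;
    this gives uniqueness. *)
Lemma freeSum_basis : is_basis (bas K c (d := d)).
Proof.
have coef_lift b (a : {malg P[bidx d]}) : pcoef b (malg_lift (bas K c (d := d)) a) = a@_b.
  rewrite /malg_lift (big_morph _ (pcoefD b) (pcoef0 _ _ b)).
  under eq_bigr do rewrite pcoefZ pcoef_bas.
  have [ba|ba] := boolP (b \in msupp a); last first.
    rewrite mcoeff_outdom // big_seq big1 // => b' b'a; case: eqP => [e|_].
      by rewrite -e b'a in ba.
    by rewrite mulr0.
  rewrite (big_fsetD1 b) //= eqxx mulr1 big1_fset ?addr0 // => b'.
  by rewrite in_fsetD1 => /andP[/negPf-> _] _; rewrite mulr0.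
move=> x; have [a ->] : exists a, x = malg_lift (bas K c (d := d)) a.
  elim/free_ind: x => [|_ _ [a ->] [b ->]|p b].
  - by exists 0; rewrite malg_lift0.
  - by exists (a + b); rewrite malg_liftD.
  - by exists << p *g b >>; rewrite malg_liftU.
exists a; split; first exact: erefl.
move=> a' e; apply/malgP => b.
exact: etrans (esym (coef_lift b a)) (etrans (congr1 (pcoef b) e) (coef_lift b a')).
Qed.

End FreeGenerators.

(** * Gradings *)

Section Gradings.
Variables (K : comNzRingType) (c : nat) (w : nat).
Local Notation P := (polyInf K c).

Definition gsum (F : zmodType) (u : {malg F[int]}) : F := \sum_(k <- msupp u) u@_k.

Lemma gsumEw (F : zmodType) (u : {malg F[int]}) (D : {fset int}) :
  (msupp u `<=` D)%fset -> gsum u = \sum_(k <- D) u@_k.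
Proof. by move=> le; rewrite /gsum (big_fset_incl _ le) //= => k _ /mcoeff_outdom. Qed.

Lemma gsumD (F : zmodType) (u v : {malg F[int]}) : gsum (u + v) = gsum u + gsum v.
Proof.
rewrite (gsumEw (msuppD_le u v)) (gsumEw (fsubsetUl (msupp u) (msupp v))).
rewrite (gsumEw (fsubsetUr (msupp u) (msupp v))) -big_split /=.
by apply: eq_bigr => k _; rewrite mcoeffD.
Qed.

Lemma gsum0 (F : zmodType) : gsum (0 : {malg F[int]}) = 0.
Proof. by rewrite /gsum msupp0 big_seq_fset0. Qed.

Lemma gsumU (F : zmodType) (x : F) k : gsum << x *g k >> = x.
Proof. by rewrite (gsumEw msuppU_le) big_seq_fset1 mcoeffUU. Qed.

Lemma malg_map (F F' : zmodType) (h : {additive F -> F'}) (u : {malg F[int]}) :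
  exists2 v : {malg F'[int]}, (forall k, v@_k = h u@_k) & gsum v = h (gsum u).
Proof.
rewrite (monalgE u); elim/big_ind: _ => [|u1 u2 [v1 e1 s1] [v2 e2 s2]|k _].
- by exists 0 => [k|]; rewrite ?mcoeff0 ?gsum0 raddf0.
- exists (v1 + v2) => [k|]; first by rewrite !mcoeffD e1 e2 raddfD.
  by rewrite !gsumD s1 s2 raddfD.
- exists << h u@_k *g k >> => [k'|]; last by rewrite !gsumU.
  by rewrite !mcoeffU raddfMn.
Qed.

Definition whomogeneous (n : nat) (a : P) :=
  forall m, m \in msupp a -> (w * mdeg m)%N = n.

(* Gradings for which the variables have degree w: w = 1 is the standard
   grading, and any module has a trivial grading for w = 0. *)
Record is_wgrading (F : symModType K c) (M : set F) (gr : int -> set F) :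
    Prop := {
  wgr_sub : forall k x, gr k x -> M x;
  wgr_zero : forall k, gr k 0;
  wgr_subr : forall k x y, gr k x -> gr k y -> gr k (x - y);
  wgr_decomp : forall x, M x -> exists2 u : {malg F[int]},
    (forall k, gr k u@_k) & x = gsum u;
  wgr_uniq : forall u : {malg F[int]}, (forall k, gr k u@_k) -> gsum u = 0 -> u = 0;
  wgr_scale : forall (n : nat) (k : int) (a : P) x,
    whomogeneous n a -> gr k x -> gr (n%:Z + k) (a *: x);
  wgr_act : forall k s x, gr k x -> gr k (symact s x) }.

Lemma wgr_add (F : symModType K c) (M : set F) gr k x y : is_wgrading M gr ->
  gr k x -> gr k y -> gr k (x + y).
Proof.
move=> hgr xk yk; rewrite -[y]opprK -[- y]sub0r; apply: (wgr_subr hgr) => //.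
by apply: (wgr_subr hgr) => //; exact: wgr_zero hgr _.
Qed.

Section FreeGrading.
Variables (r : nat) (d : 'I_r -> nat) (deg : 'I_r -> int).
Local Notation G := (freeSum K c d).

(** Degree in the free module whose [i]-th summand is generated in degree [deg i]. *)
Definition tdeg (t : fmon c d) : int := (w * mdeg t.2)%N%:Z + deg (tag t.1).

Definition free_gr (k : int) (x : G) := forall t, coef t x != 0 -> tdeg t = k.

Lemma free_gr_bas b : free_gr (deg (tag b)) (bas K c b).
Proof.
move=> [b' m]; rewrite /coef [X in X@__]pcoef_bas /tdeg /=.
have [<-|_] := eqVneq b b'; last by rewrite [X in X != 0]mcoeff0 eqxx.
rewrite [X in X != 0]mcoeff1; case: (eqVneq m mone) => [->|_]; last by rewrite eqxx.
by rewrite mdeg1 muln0 add0r.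
Qed.

(** A monomial occurs only in the component of its own degree, so components of different degrees
    cannot cancel. *)
Lemma free_wgrading : is_wgrading setT free_gr.
Proof.
have uniq (u : {malg G[int]}) : (forall k, free_gr k u@_k) -> gsum u = 0 -> u = 0.
  move=> uk u0; apply/malgP => k; rewrite [RHS]mcoeff0; apply: coef_ext => t.
  have [tk|tk] := eqVneq (tdeg t) k; last first.
    apply/eqP; apply: contraNT tk => ct; exact/eqP/(uk k).
  have : coef t (gsum u) = 0 by rewrite u0 coef0.
  rewrite /gsum (big_morph _ (coefD (K := K) t) (coef0 K t)).
  have [ku|ku] := boolP (k \in msupp u); last first.
    by rewrite (mcoeff_outdom ku) coef0.
  rewrite (big_fsetD1 k) //= big1_fset ?addr0 // => k'.
  rewrite in_fsetD1 => /andP[k'k _] _; apply/eqP; apply: contraNT k'k => ct.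
  by rewrite -tk (uk k' _ ct).
split=> //.
- by move=> k t; rewrite coef0 eqxx.
- move=> k x y xk yk t; rewrite coefB => cxy.
  have [cx|] := eqVneq (coef t x) 0; last exact: xk.
  by apply: yk; rewrite cx sub0r oppr_eq0 in cxy.
- move=> x _; elim/free_ind: x => [|x y [u uk ->] [v vk ->]|a b].
  + exists 0 => [k t|]; last by rewrite gsum0.
    by rewrite [X in coef _ X]mcoeff0 coef0 eqxx.
  + exists (u + v) => [k t|]; last by rewrite gsumD.
    rewrite [X in coef _ X]mcoeffD coefD => cuv.
    have [cu|] := eqVneq (coef t u@_k) 0; last exact: uk.
    by apply: vk; rewrite cu add0r in cuv.
  + elim/poly_ind: a => [|p q [u uk pu] [v vk qv]|a m].
    * exists 0 => [k t|]; last by rewrite gsum0 scale0r.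
      by rewrite [X in coef _ X]mcoeff0 coef0 eqxx.
    * exists (u + v) => [k t|]; last by rewrite gsumD scalerDl pu qv.
      rewrite [X in coef _ X]mcoeffD coefD => cuv.
      have [cu|] := eqVneq (coef t u@_k) 0; last exact: uk.
      by apply: vk; rewrite cu add0r in cuv.
    * exists << (<< a *g m >> : P) *: bas K c b *g tdeg (b, m) >>; last by rewrite gsumU.
      move=> k t; rewrite [X in coef _ X]mcoeffU.
      case: (eqVneq (tdeg (b, m)) k) => [<-|_]; last by rewrite mulr0n coef0 eqxx.
      rewrite mulr1n /coef [X in X@__]pcoefZ [X in _ * X]pcoef_bas.
      case: t => b' m' /=; have [<-|_] := eqVneq b b'; last first.
        by rewrite mulr0 [X in X != 0]mcoeff0 eqxx.
      rewrite mulr1 [X in X != 0]mcoeffU.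
      by case: (eqVneq m m') => [->//|_]; rewrite mulr0n eqxx.
- move=> n k a x an xk t; rewrite /coef [X in X@__]pcoefZ mcoeff_neq0.
  move=> /msuppM_le[m1 [m2 [/an m1n]]]; rewrite -mcoeff_neq0 => m2x tm.
  rewrite -(xk (t.1, m2) m2x) /tdeg tm mdegM mulnDr m1n PoszD /=.
  by rewrite addrA.
- move=> k s x xk t; rewrite -(tactV s t) coef_tact => /xk <-.
  by rewrite /tdeg /= mdeg_monmap.
Qed.

End FreeGrading.
End Gradings.

(** * Resolutions *)

Section Resolution.
Variables (K : comNzRingType) (c : nat) (w : nat).
Local Notation P := (polyInf K c).

(** Each generator is replaced by its finitely many homogeneous components, stored together with
    their degrees. *)
Lemma homogeneous_generators (F : symModType K c) (M : set F) gr :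
  is_wgrading w M gr -> forall g : seq F, (forall x, x \in g -> M x) ->
  exists2 h : seq (F * int), (forall p, p \in h -> gr p.2 p.1) &
    (forall x, x \in g -> gensub [seq p.1 | p <- h] x).
Proof.
move=> hgr; elim=> [|x g IHg] gM; first by exists [::].
have [|h hh gh] := IHg; first by move=> y yg; apply: gM; rewrite inE yg orbT.
have [|u uk xu] := wgr_decomp hgr (x := x); first by apply: gM; rewrite inE eqxx.
pose h' := [seq (u@_k, k) | k <- enum_fset (msupp u)].
exists (h' ++ h) => [p|y].
  by rewrite mem_cat => /orP[/mapP[k _ ->]|/hh//]; exact: uk.
have hS := gensub_submodule [seq p.1 | p <- h' ++ h].
rewrite inE => /predU1P[->|/gh yh]; last first.
  apply: gensub_sub yh => // z zh; apply: gensub_mem.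
  by rewrite map_cat mem_cat zh orbT.
rewrite xu /gsum big_seq; apply: (big_ind (gensub [seq p.1 | p <- h' ++ h])).
- exact: (subm0 hS).
- exact: (submD hS).
- move=> k ku; apply: gensub_mem; rewrite map_cat mem_cat -map_comp.
  by apply/orP; left; apply/mapP; exists k.
Qed.

Lemma free_lift_gr r (d : 'I_r -> nat) (deg : 'I_r -> int) (F : symModType K c)
    (M : set F) gr (v : bidx d -> F) : is_wgrading w M gr ->
  (forall b, gr (deg (tag b)) (v b)) ->
  forall k (x : freeSum K c d), free_gr w deg k x -> gr k (free_lift v x).
Proof.
move=> hgr vk k x xk; rewrite /free_lift /malg_lift.
have gsumP (J : Type) (s : seq J) (h : J -> F) :
    (forall j, gr k (h j)) -> gr k (\sum_(j <- s) h j).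
  move=> hk; apply: big_ind => // [|y z yk zk]; first exact: (wgr_zero hgr).
  exact: (wgr_add hgr).
apply: (gsumP) => i; apply: (gsumP) => f.
pose b : bidx d := Tagged (fun i => HomFI (d i)) f.
(* The degree of the scalar has to be a natural number; it is read off a monomial of the
   coefficient, so a zero coefficient is treated apart. *)
rewrite -/(pcoef b x); have [->|/eqP p0] := eqVneq (pcoef b x) 0.
  by rewrite scale0r; exact: (wgr_zero hgr).
have [m m_p] : exists m, m \in msupp (pcoef b x).
  apply: contrapT => nm; apply: p0; apply/malgP => m; rewrite [RHS]mcoeff0.
  by apply: mcoeff_outdom; apply/negP => m_p; apply: nm; exists m.
have degP m' : m' \in msupp (pcoef b x) -> (w * mdeg m')%N%:Z + deg i = k.
  by rewrite -mcoeff_neq0 => /(xk (b, m')).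
rewrite -(degP m m_p); apply: (wgr_scale hgr); last exact: (vk b).
by move=> m' /degP; rewrite -(degP m m_p) => /addIr[].
Qed.

Lemma kernel_submodule (F F' : symModType K c) (h : {linear F -> F'}) :
  equivariant h -> is_sym_submodule (fun x => h x = 0).
Proof.
move=> h_eq; split=> [|x y x0 y0|a x x0|s x x0]; first exact: raddf0.
- by rewrite linearD x0 y0 addr0.
- by rewrite linearZ x0 /= scaler0.
- by rewrite h_eq x0 symact0.
Qed.

(** If [h x = 0], the images of the components of [x] are a decomposition of 0 in the target, so
    each vanishes by uniqueness there. *)
Lemma kernel_wgrading (F F' : symModType K c) (h : {linear F -> F'})
    (M' : set F') gr gr' : equivariant h ->
  is_wgrading w setT gr -> is_wgrading w M' gr' ->
  (forall k x, gr k x -> gr' k (h x)) ->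
  is_wgrading w (fun x => h x = 0) (fun k x => gr k x /\ h x = 0).
Proof.
move=> h_eq hgr hgr' h_gr; have hK := kernel_submodule h_eq; split.
- by move=> k x [].
- by move=> k; split; [exact: (wgr_zero hgr) | exact: (subm0 hK)].
- move=> k x y [xk x0] [yk y0]; split; first exact: (wgr_subr hgr).
  exact: (submB hK).
- move=> x x0; have [u uk xu] := wgr_decomp hgr (x := x) I.
  have [v vE vs] := malg_map h u.
  have v0 : v = 0.
    apply: (wgr_uniq hgr') => [k|]; first by rewrite vE; apply: h_gr.
    by rewrite vs -xu.
  by exists u => // k; split; rewrite // -vE v0 mcoeff0.
- by move=> u uk; apply: (wgr_uniq hgr) => k; have [] := uk k.
- move=> n k a x an [xk x0]; split; first exact: (wgr_scale hgr).
  exact: (submZ hK).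
- move=> k s x [xk x0]; split; first exact: (wgr_act hgr).
  exact: (subm_act hK).
Qed.

(** A generator fixed by all permutations fixing the first [n] columns is the image of the standard
    generator of a copy of [freeSym K c n]; homogeneous generators also supply the degrees. *)
Lemma free_cover (F : symModType K c) (M : set F) gr :
  sym_noetherian F -> fin_width F -> is_sym_submodule M -> is_wgrading w M gr ->
  exists r (d : 'I_r -> nat) (deg : 'I_r -> int) (h : {linear freeSum K c d -> F}),
  [/\ equivariant h, forall x, M x <-> exists y, h y = x &
      forall k y, free_gr w deg k y -> gr k (h y)].
Proof.
move=> F_noeth F_width hM hgr; have [g0 g0M Mg0] := F_noeth M hM.
have [g gg g0g] := homogeneous_generators hgr g0M.
have Mg x : M x -> gensub [seq p.1 | p <- g] x.
  move=> /Mg0; apply: gensub_sub; [exact: gensub_submodule | exact: g0g].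
have [n nP] := choice F_width.
pose q (i : 'I_(size g)) := tnth (in_tuple g) i.
have qgr i : gr (q i).2 (q i).1 by apply: gg; exact: mem_tnth.
pose d i := n (q i).1.
have [ext extP] := choice (@bact_ext _ d).
(* A basis vector goes to the translate of its generator by any permutation extending the injection;
   [ext] chooses one. *)
pose v b := symact (ext b) (q (tag b)).1.
have vE s b : v (bact s b) = symact s (v b).
  (* [ext (bact s b)] and [s * ext b] extend the same injection, so they differ by a right factor
     fixing the first [d] columns, which fixes the generator. *)
  rewrite /v -symactM /=; have ss : (ext (bact s b) = (s * ext b) *
      ((s * ext b)^-1 * ext (bact s b)))%g by rewrite mulgA mulgV mul1g.
  rewrite ss symactM; congr symact; apply: nP => j jd.
  have /bact_bid/(_ j jd) : bact (ext (bact s b)) (bid d (tag b)) =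
      bact (s * ext b)%g (bid d (tag b)) by rewrite bactM extP -[RHS]extP.
  by move=> /= ->; exact: sym_funK (s * ext b)%g j.
exists (size g), d, (fun i => (q i).2), (free_lift v); split.
- exact: free_lift_equivariant.
- have vM b : M (v b) by apply: subm_act => //; exact: (wgr_sub hgr (qgr _)).
  move=> x; split=> [Mx|[y <-]]; last exact: free_lift_sub.
  suff : is_sym_submodule (fun x => exists y, free_lift v y = x).
    move=> hI; apply: (gensub_sub hI _ (Mg x Mx)) => _ /mapP[p pg ->].
    have /tnthP[i ->] : p \in in_tuple g by [].
    exists (bas K c (bid d i)); rewrite free_lift_bas /v /=; apply: nP.
    by apply: (proj1 (bact_bid d _ 1%g i)); rewrite extP bact1.
  split=> [|_ _ [y <-] [z <-]|a _ [y <-]|s _ [y <-]].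
  + by exists 0; exact: free_lift0.
  + by exists (y + z); exact: free_liftD.
  + by exists (a *: y); exact: free_liftZ.
  + by exists (symact s y); exact: free_lift_equivariant.
- apply: (free_lift_gr hgr) => b.
  by apply: (wgr_act hgr); exact: qgr.
Qed.

(** The state of the iteration: a free module with the submodule still to be covered, namely the
    kernel of the map just built. [st_grW] lets a map of degree zero into that kernel be read as one
    into the whole free module. *)
Record stage := Stage {
  st_r : nat;
  st_d : 'I_st_r -> nat;
  st_deg : 'I_st_r -> int;
  st_sub : set (freeSum K c st_d);
  st_gr : int -> set (freeSum K c st_d);
  st_subP : is_sym_submodule st_sub;
  st_grP : is_wgrading w st_sub st_gr;
  st_grW : forall k x, st_gr k x -> free_gr w st_deg k x }.

Arguments st_d : clear implicits.
Arguments st_deg : clear implicits.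
Arguments st_sub : clear implicits.

Definition st_mod S := freeSum K c (st_d S).

Lemma next_stage (F : symModType K c) (M : set F) gr :
  sym_noetherian F -> fin_width F -> is_sym_submodule M -> is_wgrading w M gr ->
  exists Sh : {S : stage & {linear st_mod S -> F}}, let h := projT2 Sh in
  [/\ equivariant h, forall x, M x <-> exists y, h y = x,
      forall k y, free_gr w (st_deg (projT1 Sh)) k y -> gr k (h y) &
      forall y, h y = 0 <-> st_sub (projT1 Sh) y].
Proof.
move=> F_noeth F_width hM hgr.
have [r [d [deg [h [h_eq h_im h_gr]]]]] := free_cover F_noeth F_width hM hgr.
pose S := Stage (kernel_submodule h_eq)
  (kernel_wgrading h_eq (free_wgrading K c w d deg) hgr h_gr)
  (fun k x => @proj1 _ _).
by exists (existT _ S h).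
Qed.

Lemma wgraded_resolution (F : symModType K c) (M : set F) gr : noetherian K ->
  sym_noetherian F -> fin_width F -> is_sym_submodule M -> is_wgrading w M gr ->
  exists (C : sym_complex F) (grC : forall n, int -> set (res_term C n)),
  [/\ is_sym_free_resolution M C,
      forall n, is_wgrading w setT (grC n),
      forall n, exists (I : choiceType) (b : I -> res_term C n) (deg : I -> int),
        is_basis b /\ forall i, grC n (deg i) (b i),
      forall k y, grC 0%N k y -> gr k (res_aug C y) &
      forall n k y, grC n.+1 k y -> grC n k (res_diff C n y)].
Proof.
move=> K_noeth F_noeth F_width hM hgr.
have [[S0 h0] [h0_eq h0_im h0_gr h0_ker]] := next_stage F_noeth F_width hM hgr.
have next S := cid (next_stage (freeSum_noetherian (d := st_d S) K_noeth)
  (freeSum_fin_width (d := st_d S)) (st_subP S) (st_grP S)).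
pose nx S := projT1 (sval (next S)).
pose h S : {linear st_mod (nx S) -> st_mod S} := projT2 (sval (next S)).
have nxP S := svalP (next S) : let h := h S in [/\ equivariant h, _, _ & _].
pose st n := iter n nx S0.
exists (@SymComplex K c F (fun n => st_mod (st n)) h0 (fun n => h (st n))).
exists (fun n => free_gr w (st_deg (st n))); split.
- split=> //=.
  + move=> n; exists _, (bas K c (d := st_d (st n))); exact: freeSum_basis.
  + by move=> n; exact: freeSum_fin_gen.
  + by move=> n; have [] := nxP (st n).
  (* The kernel of each map is the submodule stored in its source stage, and this is the image of
     the next map. *)
  + move=> y; rewrite h0_ker; have [_ + _ _] := nxP S0; exact.
  + move=> n y; have [_ _ _ ->] := nxP (st n).
    by have [_ + _ _] := nxP (st n.+1); exact.
- by move=> n; exact: free_wgrading.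
- move=> n; exists _, (bas K c (d := st_d (st n))), (fun b => st_deg (st n) (tag b)).
  by split; [exact: freeSum_basis | exact: free_gr_bas].
- exact: h0_gr.
- move=> n k y yk; have [_ _ + _] := nxP (st n) => /(_ k y yk).
  exact: st_grW.
Qed.

End Resolution.

Lemma is_gradingP (K : comNzRingType) (c : nat) (F : symModType K c) (M : set F) gr :
  is_sym_submodule M -> is_grading M gr <-> is_wgrading 1 M gr.
Proof.
move=> hM; have homE n (a : polyInf K c) : homogeneous n a <-> whomogeneous 1 n a.
  by split=> an m /an; rewrite mul1n.
split=> hgr.
- have uniq (u : {malg F[int]}) : (forall k, gr k u@_k) -> gsum u = 0 -> u = 0.
    (* Uniqueness is applied to the element 0, which is both [gsum u] and the empty sum. *)
    move=> uk u0; have [v [_ v_uniq]] := gr_decomp hgr (subm0 hM).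
    rewrite -(v_uniq u) //; apply: v_uniq; split; last by rewrite msupp0 big_seq_fset0.
    by move=> k; rewrite mcoeff0; exact: gr_zero hgr _.
  split=> //.
  + exact: gr_sub hgr.
  + exact: gr_zero hgr.
  + exact: gr_subr hgr.
  + by move=> x /(gr_decomp hgr)[u [[uk xu] _]]; exists u.
  + by move=> n k a x /homE an xk; apply: (gr_scale hgr).
  + exact: gr_act hgr.
- split.
  + exact: wgr_sub hgr.
  + exact: wgr_zero hgr.
  + exact: wgr_subr hgr.
  + move=> x /(wgr_decomp hgr)[u uk xu]; exists u; split=> // v [vk xv].
    have [mv mvk mvs] := malg_map -%R v.
    have smv : gsum (u + mv) = 0 by rewrite gsumD mvs -xu [gsum v](esym xv) subrr.
    have e : u + mv = 0.
      apply: (wgr_uniq hgr) smv => k; rewrite mcoeffD mvk.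
      exact: (wgr_subr hgr).
    apply/malgP => k; move/(congr1 (mcoeff k)): e.
    by rewrite mcoeffD mvk mcoeff0 => /eqP; rewrite subr_eq0 => /eqP.
  + by move=> n k a x /homE an xk; apply: (wgr_scale hgr).
  + exact: wgr_act hgr.
Qed.

(** For weight 0 all nonzero polynomials have degree 0, so concentrating [M] in degree 0 is a
    grading. This makes the ungraded statement an instance of the graded construction. *)
Lemma trivial_wgrading (K : comNzRingType) (c : nat) (F : symModType K c)
    (M : set F) : is_sym_submodule M ->
  is_wgrading 0 M (fun k x => if k == 0 then M x else x = 0).
Proof.
move=> hM; split.
- by move=> k x; case: eqP => // _ ->; exact: subm0.
- by move=> k; case: eqP => // _; exact: subm0.
- by move=> k x y; case: eqP => [_|_ -> ->]; [exact: submB | rewrite subr0].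
- move=> x Mx; exists << x *g 0 >>; last by rewrite gsumU.
  by move=> k; rewrite mcoeffU eq_sym; case: eqP.
- move=> u uk u0; apply/malgP => k; rewrite mcoeff0.
  have [->|/negPf k0] := eqVneq k 0; last by have := uk k; rewrite k0.
  rewrite -u0 (gsumEw (fsubsetUr [fset (0 : int)]%fset (msupp u))).
  rewrite (big_fsetD1 (0 : int)) ?inE //= big1_fset ?addr0 // => j.
  by rewrite in_fsetD1 => /andP[/negPf j0 _] _; have := uk j; rewrite j0.
(* The zero polynomial is homogeneous of every degree; a nonzero one has a monomial, which forces
   [n] to be 0. *)
- move=> n k a x an; have [->|a0] := eqVneq a 0.
    move=> _; rewrite scale0r; case: eqP => // _; exact: subm0.
  have [m /an] : exists m, m \in msupp a.
    by apply/fset0Pn; rewrite msupp_eq0.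
  rewrite mul0n => <-; rewrite add0r; case: eqP => [_|_ ->]; first exact: submZ.
  by rewrite scaler0.
- move=> k s x; case: eqP => [_|_ ->]; [exact: subm_act | exact: symact0].
Qed.

(** Submodules are only pushed forward along [f], so linearity and equivariance of the inverse never
    have to be established. *)
Lemma equivariant_bij_noetherian (K : comNzRingType) (c : nat)
    (F G : symModType K c) (f : {linear F -> G}) :
  equivariant f -> bijective f -> sym_noetherian G -> sym_noetherian F.
Proof.
move=> f_eq [f' fK f'K] G_noeth.
have image (N : set F) : is_sym_submodule N ->
    is_sym_submodule (fun y => exists2 x, N x & f x = y).
  move=> hN; split=> [|_ _ [x Nx <-] [y Ny <-]|a _ [x Nx <-]|s _ [x Nx <-]].
  - by exists 0; [exact: subm0 | exact: raddf0].
  - by exists (x + y); [exact: submD | exact: raddfD].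
  - by exists (a *: x); [exact: submZ | exact: linearZ].
  - by exists (symact s x); [exact: subm_act | exact: f_eq].
move=> M hM; have [g gM Mg] := G_noeth _ (image M hM).
exists (map f' g) => [_ /mapP[y /gM[x Mx <-] ->]|x Mx N hN gN]; first by rewrite fK.
have [||x' Nx' /(can_inj fK) <-//] := Mg (f x) _ _ (image N hN); first by exists x.
by move=> y yg; exists (f' y); [apply: gN; exact: map_f | exact: f'K].
Qed.

Lemma equivariant_inj_fin_width (K : comNzRingType) (c : nat)
    (F G : symModType K c) (f : {linear F -> G}) :
  equivariant f -> injective f -> fin_width G -> fin_width F.
Proof.
move=> f_eq f_inj G_width x; have [n nP] := G_width (f x).
by exists n => s /nP; rewrite -f_eq => /f_inj.
Qed.

Theorem theorem5p1 (K : comNzRingType) (c : nat) (F : symModType K c)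
    (M : set F) :
  noetherian K -> fin_gen_free_sym F -> is_sym_submodule M ->
  (exists C : sym_complex F, is_sym_free_resolution M C) /\
  (forall gr : int -> set F, is_grading M gr ->
    exists (C : sym_complex F) (grC : forall n, int -> set (res_term C n)),
      is_sym_free_resolution M C /\ is_graded_resolution gr grC).
Proof.
move=> K_noeth [r [d [f [f_eq f_bij]]]] hM.
have F_noeth := equivariant_bij_noetherian f_eq f_bij
  (freeSum_noetherian (d := d) K_noeth).
have F_width := equivariant_inj_fin_width f_eq (bij_inj f_bij)
  (freeSum_fin_width (d := d)).
split=> [|gr hgr].
  have [C [_ [hC _ _ _ _]]] := wgraded_resolution K_noeth F_noeth F_width hM
    (trivial_wgrading hM).
  by exists C.
have [C [grC [hC grCP grCb aug_gr diff_gr]]] := wgraded_resolution K_noeth F_noeth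
  F_width hM (proj1 (is_gradingP gr hM) hgr).
exists C, grC; split=> //; split=> // n; split; last exact: grCb.
exact/is_gradingP.
Qed.
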